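(* Let $k\geq 2$ and let $L=(l_1,\dots,l_k)$ be positive integers with $l_1+\dots+l_k=n$ which are generic and reduced. Then the geometric realization of the generalized tonnetz $Tonn^{n,k}(L)$ is homeomorphic to the $(k-1)$-dimensional torus $T^{k-1}=(S^1)^{k-1}$, i.e. $Tonn^{n,k}(L)$ is a triangulation of $T^{k-1}$.
   Context: Elements of $[n]$ are identified with elements of $\mathbb{Z}_n$. $L=(l_1,\dots,l_k)$ is generic if for all subsets $I,J\subseteq[k]$, $\sum_{i\in I}l_i=\sum_{j\in J}l_j$ implies $I=J$. $L$ is reduced if $\gcd(l_1,\dots,l_k)=1$. The generalized tonnetz $Tonn^{n,k}(L)$ is the simplicial complex on vertex set $\mathbb{Z}_n$ whose maximal simplices are the sets $\Delta(x;\sigma)=\{x,\,x+l_{\sigma(1)},\,x+l_{\sigma(1)}+l_{\sigma(2)},\dots,x+l_{\sigma(1)}+\dots+l_{\sigma(k-1)}\}$ (sums in $\mathbb{Z}_n$), for $x\in\mathbb{Z}_n$ and $\sigma\in S_k$; its simplices are all subsets of these sets. *)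

(* Defs.v *)
From Stdlib Require Import Reals List Permutation Arith.
Import ListNotations.
Open Scope R_scope.

(* l_i for i in {0,...,k-1} (0-based indexing of L = [l_1; ...; l_k]) *)
Definition lval (L : list nat) (i : nat) : nat := nth i L 0%nat.

Definition subsum (L : list nat) (I : nat -> bool) : nat :=
  list_sum (map (fun i => if I i then lval L i else 0%nat) (seq 0 (length L))).

Definition generic (L : list nat) : Prop :=
  forall I J : nat -> bool, subsum L I = subsum L J ->
    forall i, (i < length L)%nat -> I i = J i.

Definition reduced (L : list nat) : Prop := fold_right Nat.gcd 0%nat L = 1%nat.

(* l_{sigma(1)} + ... + l_{sigma(j)}, sigma given as the list [sigma(1);...;sigma(k)]
   (a permutation of [0;...;k-1]) *)
Definition psum (L : list nat) (s : list nat) (j : nat) : nat :=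
  list_sum (map (lval L) (firstn j s)).

Definition tonn_max_simplex (n : nat) (L : list nat) (x : nat) (s : list nat)
  : list nat :=
  map (fun j => ((x + psum L s j) mod n)%nat) (seq 0 (length L)).

Definition tonn_simplex (n : nat) (L : list nat) (S : nat -> Prop) : Prop :=
  exists x s, (x < n)%nat /\ Permutation s (seq 0 (length L)) /\
    forall v, S v -> In v (tonn_max_simplex n L x s).

(* Geometric realization of Tonn^{n,k}(L) inside R^n (= functions nat -> R
   vanishing from coordinate n on), vertex v ↦ standard basis vector e_v:
   points are barycentric coordinate vectors whose support is a simplex. *)
Definition tonn_realization (n : nat) (L : list nat) (p : nat -> R) : Prop :=
  (forall v, 0 <= p v) /\
  (forall v, (n <= v)%nat -> p v = 0) /\
  fold_right Rplus 0 (map p (seq 0 n)) = 1 /\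
  tonn_simplex n L (fun v => p v <> 0).

(* The torus (S^1)^d inside R^{2d}: coordinates (t_{2i}, t_{2i+1}) on the unit circle *)
Definition torus (d : nat) (t : nat -> R) : Prop :=
  (forall i, (i < d)%nat -> t (2 * i)%nat ^ 2 + t (2 * i + 1)%nat ^ 2 = 1) /\
  (forall j, (2 * d <= j)%nat -> t j = 0).

Definition continuous_on (m1 m2 : nat) (A : (nat -> R) -> Prop)
  (f : (nat -> R) -> (nat -> R)) : Prop :=
  forall p, A p -> forall eps, 0 < eps -> exists delta, 0 < delta /\
    forall q, A q -> (forall i, (i < m1)%nat -> Rabs (q i - p i) < delta) ->
      forall j, (j < m2)%nat -> Rabs (f q j - f p j) < eps.

Definition homeomorphic (m1 m2 : nat) (A B : (nat -> R) -> Prop) : Prop :=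
  exists f g : (nat -> R) -> (nat -> R),
    (forall p, A p -> B (f p)) /\
    (forall q, B q -> A (g q)) /\
    (forall p, A p -> forall i, g (f p) i = p i) /\
    (forall q, B q -> forall i, f (g q) i = q i) /\
    continuous_on m1 m2 A f /\
    continuous_on m2 m1 B g.

(* Main.v *)
Require Import Defs.
From Stdlib Require Import Reals List Permutation Arith.
From Stdlib Require Import Lra Lia ZArith Sorted ClassicalEpsilon.
Import ListNotations.
Local Open Scope R_scope.

(** Let [K] be the lattice of the [x] in Z^k with [l.x] in [nZ], taken modulo the
    diagonal [(1,...,1)].  Sending [x] to [l.x mod n] identifies the tonnetz with the
    quotient by [K] of the Coxeter triangulation of [V = R^k / R(1,...,1)], whose
    simplices are [{X, X + e_s(1), X + e_s(1) + e_s(2), ...}]; and [V / K] is a torus.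

    Explicitly, genericity recovers from the residue [v - b mod n] of two vertices of
    a simplex the set of steps leading from [b] to [v], so a point with barycentric
    coordinates [p] lifts affinely to R^k once a base vertex [b] is chosen.  Changing
    [b] changes the lift by an element of [K] and a multiple of [(1,...,1)], so the
    map to [V / K] is well defined and, keeping [b] fixed near [p], continuous.  It is
    surjective: sorting the fractional parts of [h] yields a simplex containing [h].
    It is injective: [p v] is the largest value of [1 - (max - min)(h - w)] over the
    integral lifts [w] of [v], when this is positive, and that quantity depends only on
    the class of [h] in [V / K].  Compactness then makes the inverse continuous. *)

(** * Continuous bijections from compact sets *)

Definition extraction (phi : nat -> nat) : Prop :=
  forall m, (phi m < phi (S m))%nat.

Lemma extraction_ge (phi : nat -> nat) (m : nat) :
  extraction phi -> (m <= phi m)%nat.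
Proof.
  intros Hphi; induction m as [|m IH]; [lia|].
  specialize (Hphi m); lia.
Qed.

Lemma extraction_lt (phi : nat -> nat) (a b : nat) :
  extraction phi -> (a < b)%nat -> (phi a < phi b)%nat.
Proof.
  intros Hphi; induction 1 as [|b Hab IH]; [apply Hphi|].
  specialize (Hphi b); lia.
Qed.

Lemma extraction_comp (phi psi : nat -> nat) :
  extraction phi -> extraction psi -> extraction (fun m => phi (psi m)).
Proof. intros Hphi Hpsi m; apply extraction_lt; auto. Qed.

Lemma Un_cv_extraction (u : nat -> R) (l : R) (phi : nat -> nat) :
  extraction phi -> Un_cv u l -> Un_cv (fun m => u (phi m)) l.
Proof.
  intros Hphi Hu eps Heps; destruct (Hu eps Heps) as [N HN].
  exists N; intros m Hm; apply HN.
  pose proof (extraction_ge phi m Hphi); lia.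
Qed.

(** Bolzano-Weierstrass yields only a cluster value [l]; the subsequence is built by recursion, each
    index lying beyond the previous one and the m-th term within 1/(m+1) of [l]. *)
Lemma bounded_subsequence (u : nat -> R) :
  (forall m, 0 <= u m <= 1) ->
  exists phi l, extraction phi /\ Un_cv (fun m => u (phi m)) l.
Proof.
  intros Hu.
  destruct (Bolzano_Weierstrass u (fun c => 0 <= c <= 1) (compact_P3 0 1) Hu)
    as [l Hl].
  assert (Hnext : forall N m : nat, exists q : nat,
             (N < q)%nat /\ Rabs (u q - l) < / INR (S m)).
  { intros N m.
    assert (Hpos : 0 < / INR (S m)) by (apply Rinv_0_lt_compat, lt_0_INR; lia).
    destruct (Hl (disc l (mkposreal _ Hpos)) (S N)) as (q & Hq & Hd).
    { exists (mkposreal _ Hpos); intros x Hx; exact Hx. }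
    exists q; split; [lia | exact Hd]. }
  pose (next := fun N m =>
    proj1_sig (constructive_indefinite_description _ (Hnext N m))).
  assert (Hn : forall N m, (N < next N m)%nat /\
                           Rabs (u (next N m) - l) < / INR (S m)).
  { intros N m; exact (proj2_sig (constructive_indefinite_description _ (Hnext N m))). }
  pose (phi := fix phi m := match m with
                            | O => next 0%nat 0%nat
                            | S m' => next (phi m') m
                            end).
  exists phi, l; split.
  - intros m; apply (Hn (phi m) (S m)).
  - intros eps Heps.
    destruct (archimed_cor1 eps Heps) as (N & HN & HN0).
    exists N; intros m Hm; unfold Rdist.
    assert (Hb : Rabs (u (phi m) - l) < / INR (S m)).
    { destruct m as [|m]; apply Hn. }
    assert (/ INR (S m) <= / INR N).
    { apply Rinv_le_contravar; [apply lt_0_INR; lia | apply le_INR; lia]. }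
    lra.
Qed.

(** One extraction per coordinate: passing to a further subsequence keeps the limits already
    obtained. *)
Lemma bounded_subsequence_vec (d : nat) (u : nat -> nat -> R) :
  (forall m i, 0 <= u m i <= 1) ->
  exists phi p, extraction phi /\
    forall i, (i < d)%nat -> Un_cv (fun m => u (phi m) i) (p i).
Proof.
  intros Hu; induction d as [|d (phi & p & Hphi & Hp)].
  - exists (fun m => m), (fun _ => 0); split; [intros m; lia | intros; lia].
  - destruct (bounded_subsequence (fun m => u (phi m) d)) as (psi & l & Hpsi & Hl).
    { intros m; apply Hu. }
    exists (fun m => phi (psi m)), (fun i => if Nat.eqb i d then l else p i).
    split; [now apply extraction_comp|].
    intros i Hi; destruct (Nat.eqb_spec i d) as [->|Hne]; [exact Hl|].
    apply (Un_cv_extraction (fun m => u (phi m) i) (p i) psi Hpsi), Hp; lia.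
Qed.

Lemma uniform_rank (d : nat) (Q : nat -> nat -> Prop) :
  (forall j, (j < d)%nat -> exists N, forall m, (N <= m)%nat -> Q j m) ->
  exists N, forall j m, (j < d)%nat -> (N <= m)%nat -> Q j m.
Proof.
  induction d as [|d IH]; intros H; [exists 0%nat; intros; lia|].
  destruct IH as [N1 H1]; [intros; apply H; lia|].
  destruct (H d) as [N2 H2]; [lia|].
  exists (max N1 N2); intros j m Hj Hm.
  destruct (Nat.eq_dec j d) as [->|]; [apply H2 | apply H1]; lia.
Qed.

(** If the inverse [g] were discontinuous at [q], points of [B] tending to [q] would have images
    staying [eps] away from [g q]. A subsequence of these images converges to some [p] in [A];
    continuity gives f(p) = q, and injectivity forces p = g(q), a contradiction. *)
Lemma homeomorphic_of_compact (m1 m2 : nat) (A B : (nat -> R) -> Prop)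
    (f : (nat -> R) -> nat -> R) :
  (forall p, A p -> forall i, 0 <= p i <= 1) ->
  (forall p, A p -> forall i, (m1 <= i)%nat -> p i = 0) ->
  (forall q, B q -> forall i, (m2 <= i)%nat -> q i = 0) ->
  (forall u p, (forall m : nat, A (u m)) ->
     (forall i, Un_cv (fun m => u m i) (p i)) -> A p) ->
  (forall p, A p -> B (f p)) ->
  continuous_on m1 m2 A f ->
  (forall p p', A p -> A p' -> (forall i, f p i = f p' i) ->
     forall i, p i = p' i) ->
  (forall q, B q -> exists p, A p /\ forall i, f p i = q i) ->
  homeomorphic m1 m2 A B.
Proof.
  intros Hbd HA0 HB0 Hclosed HAB Hcont Hinj Hsurj.
  destruct (choice (fun q p => B q -> A p /\ forall i, f p i = q i)) as [g Hg].
  { intros q; destruct (classic (B q)) as [Hq|Hq].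
    - destruct (Hsurj q Hq) as [p Hp]; exists p; auto.
    (* Outside [B] the value of the inverse is arbitrary. *)
    - exists q; tauto. }
  exists f, g; repeat split.
  - exact HAB.
  - intros q Hq; apply Hg, Hq.
  - intros p Hp; destruct (Hg (f p) (HAB p Hp)) as [H1 H2].
    apply Hinj; auto.
  - intros q Hq; apply Hg, Hq.
  - exact Hcont.
  - intros q Hq eps Heps.
    apply NNPP; intros Hno.
    destruct (choice (fun (m : nat) q' => B q' /\
                 (forall i, (i < m2)%nat -> Rabs (q' i - q i) < / INR (S m)) /\
                 exists j, (j < m1)%nat /\ eps <= Rabs (g q' j - g q j)))
      as [w Hw].
    { intros m; apply NNPP; intros Hno'; apply Hno.
      exists (/ INR (S m)); split.
      { apply Rinv_0_lt_compat, lt_0_INR; lia. }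
      intros q' Hq' Hclose j Hj.
      apply Rnot_le_lt; intros Hle; apply Hno'.
      exists q'; repeat split; auto; exists j; auto. }
    assert (Hu : forall m, A (g (w m))) by (intros m; apply Hg, Hw).
    destruct (bounded_subsequence_vec m1 (fun m => g (w m))) as (phi & p0 & Hphi & Hp0).
    { intros m; apply Hbd, Hu. }
    (* [p0] is a limit only in the coordinates below [m1]; the others vanish along the whole
       sequence. *)
    pose (p := fun i => if Nat.ltb i m1 then p0 i else 0).
    assert (Hlim : forall i, Un_cv (fun m => g (w (phi m)) i) (p i)).
    { intros i; unfold p; destruct (Nat.ltb_spec i m1) as [Hi|Hi]; [auto|].
      intros e He; exists 0%nat; intros m _.
      rewrite (HA0 _ (Hu (phi m)) i Hi); unfold Rdist.
      rewrite Rminus_diag, Rabs_R0; exact He. }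
    assert (Hp : A p) by (apply (Hclosed (fun m => g (w (phi m)))); auto).
    assert (Hnear : forall e, 0 < e -> exists N, forall j m, (j < m1)%nat ->
              (N <= m)%nat -> Rabs (g (w (phi m)) j - p j) < e).
    { intros e He; apply (uniform_rank m1 (fun j m => Rabs (g (w (phi m)) j - p j) < e)).
      intros j _; destruct (Hlim j e He) as [N HN]; exists N.
      intros m Hm; apply HN; lia. }
    assert (Hfp : forall i, f p i = f (g q) i).
    { intros i; rewrite (proj2 (Hg q Hq)).
      destruct (Nat.lt_ge_cases i m2) as [Hi|Hi].
      2: rewrite (HB0 _ (HAB p Hp)), (HB0 q Hq); auto.
      apply cond_eq; intros e He.
      destruct (Hcont p Hp (e / 2)) as (delta & Hdelta & Hd); [lra|].
      destruct (Hnear delta Hdelta) as [N1 HN1].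
      destruct (archimed_cor1 (e / 2)) as (N2 & HN2 & HN20); [lra|].
      set (m := max N1 N2).
      assert (H1 : Rabs (f (g (w (phi m))) i - f p i) < e / 2).
      { apply Hd; auto; intros j Hj; apply HN1; auto; unfold m; lia. }
      rewrite (proj2 (Hg _ (proj1 (Hw (phi m))))) in H1.
      destruct (Hw (phi m)) as (_ & H2 & _); specialize (H2 i Hi).
      assert (/ INR (S (phi m)) <= / INR N2).
      { apply Rinv_le_contravar; [apply lt_0_INR; lia | apply le_INR].
        pose proof (extraction_ge phi m Hphi); unfold m in *; lia. }
      replace (f p i - q i)
        with (- (w (phi m) i - f p i) + (w (phi m) i - q i)) by ring.
      eapply Rle_lt_trans; [apply Rabs_triang|]; rewrite Rabs_Ropp; lra. }
    assert (Heq := Hinj p (g q) Hp (proj1 (Hg q Hq)) Hfp).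
    destruct (Hnear eps Heps) as [N HN].
    destruct (Hw (phi N)) as (_ & _ & j & Hj & Hge).
    specialize (HN j N Hj (le_n N)); rewrite Heq in HN; lra.
Qed.

(** * Finite sums *)

(** Convertible with the sum in [tonn_realization], so that the normalization of barycentric
    coordinates reads [rsum n p = 1]. *)
Definition rsum (d : nat) (F : nat -> R) : R :=
  fold_right Rplus 0 (map F (seq 0 d)).

Lemma rsum_0 (F : nat -> R) : rsum 0 F = 0.
Proof. reflexivity. Qed.

Lemma rsum_head (d : nat) (F : nat -> R) :
  rsum (S d) F = F 0%nat + rsum d (fun i => F (S i)).
Proof.
  unfold rsum; cbn [seq map fold_right]; now rewrite <- seq_shift, map_map.
Qed.

Lemma rsum_ext (d : nat) (F G : nat -> R) :
  (forall i, (i < d)%nat -> F i = G i) -> rsum d F = rsum d G.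
Proof.
  revert F G; induction d as [|d IH]; intros F G H; [reflexivity|].
  rewrite !rsum_head, H by lia; f_equal; apply IH; intros; apply H; lia.
Qed.

Lemma rsum_plus (d : nat) (F G : nat -> R) :
  rsum d (fun i => F i + G i) = rsum d F + rsum d G.
Proof.
  revert F G; induction d as [|d IH]; intros F G.
  - rewrite !rsum_0; ring.
  - rewrite !rsum_head, IH; ring.
Qed.

Lemma rsum_scal (d : nat) (a : R) (F : nat -> R) :
  rsum d (fun i => a * F i) = a * rsum d F.
Proof.
  revert F; induction d as [|d IH]; intros F.
  - rewrite !rsum_0; ring.
  - rewrite !rsum_head, IH; ring.
Qed.

Lemma rsum_minus (d : nat) (F G : nat -> R) :
  rsum d (fun i => F i - G i) = rsum d F - rsum d G.
Proof.
  rewrite (rsum_ext d _ (fun i => F i + -1 * G i)) by (intros; ring).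
  rewrite rsum_plus, rsum_scal; ring.
Qed.

Lemma rsum_const_0 (d : nat) : rsum d (fun _ => 0) = 0.
Proof.
  induction d as [|d IH]; [reflexivity|]; rewrite rsum_head, IH; ring.
Qed.

Lemma rsum_swap (d e : nat) (F : nat -> nat -> R) :
  rsum d (fun i => rsum e (fun j => F i j)) =
  rsum e (fun j => rsum d (fun i => F i j)).
Proof.
  revert F; induction d as [|d IH]; intros F.
  - rewrite rsum_0; symmetry; apply rsum_const_0.
  - rewrite rsum_head, IH, <- rsum_plus.
    apply rsum_ext; intros; now rewrite rsum_head.
Qed.

Lemma rsum_le (d : nat) (F G : nat -> R) :
  (forall i, (i < d)%nat -> F i <= G i) -> rsum d F <= rsum d G.
Proof.
  revert F G; induction d as [|d IH]; intros F G H.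
  - rewrite !rsum_0; lra.
  - rewrite !rsum_head; apply Rplus_le_compat; [apply H; lia|].
    apply IH; intros; apply H; lia.
Qed.

Lemma rsum_nonneg (d : nat) (F : nat -> R) :
  (forall i, (i < d)%nat -> 0 <= F i) -> 0 <= rsum d F.
Proof. intros H; rewrite <- (rsum_const_0 d); now apply rsum_le. Qed.

Lemma rsum_delta (d m : nat) (F : nat -> R) :
  (m < d)%nat -> rsum d (fun i => if Nat.eqb i m then F i else 0) = F m.
Proof.
  revert m F; induction d as [|d IH]; intros m F Hm; [lia|].
  rewrite rsum_head; destruct m as [|m]; cbn [Nat.eqb].
  - rewrite rsum_const_0; ring.
  - rewrite (IH m (fun i => F (S i))) by lia; ring.
Qed.

Lemma rsum_term_le (d m : nat) (F : nat -> R) :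
  (forall i, (i < d)%nat -> 0 <= F i) -> (m < d)%nat -> F m <= rsum d F.
Proof.
  intros H Hm; rewrite <- (rsum_delta d m F Hm); apply rsum_le.
  intros i Hi; specialize (H i Hi); destruct (Nat.eqb i m); lra.
Qed.

Lemma rsum_Rabs_le (d : nat) (F : nat -> R) :
  Rabs (rsum d F) <= rsum d (fun i => Rabs (F i)).
Proof.
  revert F; induction d as [|d IH]; intros F.
  - rewrite !rsum_0, Rabs_R0; lra.
  - rewrite !rsum_head; eapply Rle_trans; [apply Rabs_triang|].
    apply Rplus_le_compat_l, IH.
Qed.

Lemma rsum_neq0_exists (d : nat) (F : nat -> R) :
  rsum d F <> 0 -> exists i, (i < d)%nat /\ F i <> 0.
Proof.
  intros H; apply NNPP; intros Hno; apply H.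
  rewrite <- (rsum_const_0 d); apply rsum_ext; intros i Hi.
  apply NNPP; intros Hne; apply Hno; eauto.
Qed.

(** * Integrality of real numbers *)

Definition isZ (x : R) : Prop := exists z : Z, x = IZR z.

Lemma isZ_IZR (z : Z) : isZ (IZR z).
Proof. now exists z. Qed.

Lemma isZ_INR (m : nat) : isZ (INR m).
Proof. exists (Z.of_nat m); apply INR_IZR_INZ. Qed.

Lemma isZ_plus (x y : R) : isZ x -> isZ y -> isZ (x + y).
Proof. intros [a ->] [b ->]; exists (a + b)%Z; now rewrite plus_IZR. Qed.

Lemma isZ_minus (x y : R) : isZ x -> isZ y -> isZ (x - y).
Proof. intros [a ->] [b ->]; exists (a - b)%Z; now rewrite minus_IZR. Qed.

Lemma isZ_mult (x y : R) : isZ x -> isZ y -> isZ (x * y).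
Proof. intros [a ->] [b ->]; exists (a * b)%Z; now rewrite mult_IZR. Qed.

Lemma isZ_rsum (d : nat) (F : nat -> R) :
  (forall i, (i < d)%nat -> isZ (F i)) -> isZ (rsum d F).
Proof.
  revert F; induction d as [|d IH]; intros F H.
  - exists 0%Z; reflexivity.
  - rewrite rsum_head; apply isZ_plus; [apply H; lia|].
    apply IH; intros; apply H; lia.
Qed.

(** * Integral linear forms *)

Definition form (d : nat) (c x : nat -> R) : R := rsum d (fun i => c i * x i).

Definition dot (L : list nat) : (nat -> R) -> R :=
  form (length L) (fun i => INR (lval L i)).

Lemma form_head (d : nat) (c x : nat -> R) :
  form (S d) c x =
  c 0%nat * x 0%nat + form d (fun i => c (S i)) (fun i => x (S i)).
Proof. apply rsum_head. Qed.

Lemma form_ext (d : nat) (c x y : nat -> R) :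
  (forall i, (i < d)%nat -> x i = y i) -> form d c x = form d c y.
Proof. intros H; apply rsum_ext; intros; now rewrite H. Qed.

Lemma form_plus (d : nat) (c x y : nat -> R) :
  form d c (fun i => x i + y i) = form d c x + form d c y.
Proof.
  unfold form; rewrite <- rsum_plus; apply rsum_ext; intros; ring.
Qed.

Lemma form_minus (d : nat) (c x y : nat -> R) :
  form d c (fun i => x i - y i) = form d c x - form d c y.
Proof.
  unfold form; rewrite <- rsum_minus; apply rsum_ext; intros; ring.
Qed.

Lemma form_scal (d : nat) (c x : nat -> R) (a : R) :
  form d c (fun i => a * x i) = a * form d c x.
Proof.
  unfold form; rewrite <- rsum_scal; apply rsum_ext; intros; ring.
Qed.

Lemma form_const (d : nat) (c : nat -> R) (a : R) :
  form d c (fun _ => a) = a * form d c (fun _ => 1).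
Proof. rewrite <- form_scal; apply form_ext; intros; ring. Qed.

Lemma form_coef_combination (d : nat) (c e x : nat -> R) (a b : R) :
  form d (fun i => a * c i + b * e i) x = a * form d c x + b * form d e x.
Proof.
  unfold form; rewrite <- !rsum_scal, <- rsum_plus; apply rsum_ext; intros; ring.
Qed.

Lemma isZ_form (d : nat) (c x : nat -> R) :
  (forall i, (i < d)%nat -> isZ (c i)) -> (forall i, (i < d)%nat -> isZ (x i)) ->
  isZ (form d c x).
Proof. intros; apply isZ_rsum; intros; apply isZ_mult; auto. Qed.

Lemma dot_cons (a : nat) (L : list nat) (x : nat -> R) :
  dot (a :: L) x = INR a * x 0%nat + dot L (fun i => x (S i)).
Proof. apply form_head. Qed.

Lemma fold_gcd_divide (L : list nat) (a : nat) :
  In a L -> Nat.divide (fold_right Nat.gcd 0%nat L) a.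
Proof.
  induction L as [|b L IH]; [easy|].
  cbn [In fold_right]; intros [->|H].
  - apply Nat.gcd_divide_l.
  - eapply Nat.divide_trans; [apply Nat.gcd_divide_r | auto].
Qed.

Lemma gcd_bezout_Z (a b : nat) :
  exists u v : Z, (u * Z.of_nat a + v * Z.of_nat b = Z.of_nat (Nat.gcd a b))%Z.
Proof.
  destruct (Nat.gcd_bezout a b) as [(u & v & H)|(u & v & H)].
  - exists (Z.of_nat u), (- Z.of_nat v)%Z; nia.
  - exists (- Z.of_nat v)%Z, (Z.of_nat u); nia.
Qed.

(* The forms [c j] together with [dot L / gcd L] are the rows of a matrix of
   GL_k(Z), built by one Bezout step per entry. *)
Lemma gcd_coordinates (L : list nat) (a : nat) :
  (0 < a)%nat -> (forall b, In b L -> (0 < b)%nat) ->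
  exists c : nat -> nat -> R,
    (forall j i, isZ (c j i)) /\
    (forall x,
       isZ (dot (a :: L) x / INR (fold_right Nat.gcd 0%nat (a :: L))) ->
       (forall j, (j < length L)%nat -> isZ (form (S (length L)) (c j) x)) ->
       forall i, (i < S (length L))%nat -> isZ (x i)) /\
    (forall y z, exists x,
       dot (a :: L) x = INR (fold_right Nat.gcd 0%nat (a :: L)) * z /\
       forall j, (j < length L)%nat -> form (S (length L)) (c j) x = y j).
Proof.
  revert a; induction L as [|b L IH]; intros a Ha HL.
  - exists (fun _ _ => 0); cbn [fold_right length]; rewrite Nat.gcd_0_r.
    assert (HR : INR a <> 0) by (apply not_0_INR; lia).
    repeat split.
    + intros; apply (isZ_IZR 0).
    + intros x [z Hz] _ i Hi; exists z; rewrite <- Hz.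
      rewrite dot_cons; unfold dot, form; cbn [length]; rewrite rsum_0.
      replace i with 0%nat by lia; field; auto.
    + intros y z; exists (fun _ => z); split; [|intros; lia].
      rewrite dot_cons; unfold dot, form; cbn [length]; rewrite rsum_0; ring.
  - destruct (IH b) as (c & Hc & Hint & Hsurj);
      [apply HL; left; auto | intros; apply HL; right; auto |].
    change (fold_right Nat.gcd 0%nat (a :: b :: L))
      with (Nat.gcd a (fold_right Nat.gcd 0%nat (b :: L))).
    set (M := b :: L) in *; set (g' := fold_right Nat.gcd 0%nat M) in *.
    set (g := Nat.gcd a g').
    assert (Hb : (0 < b)%nat) by (apply HL; left; auto).
    assert (Hg' : INR g' <> 0).
    { apply not_0_INR; intros H0.
      destruct (fold_gcd_divide M b (or_introl eq_refl)) as [q Hq].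
      fold g' in Hq; lia. }
    assert (Hg : INR g <> 0).
    { apply not_0_INR; unfold g; intros H0.
      apply Nat.gcd_eq_0_l in H0; lia. }
    destruct (Nat.gcd_divide_l a g') as [al Hal].
    destruct (Nat.gcd_divide_r a g') as [be Hbe].
    fold g in Hal, Hbe.
    destruct (gcd_bezout_Z a g') as (u & v & Huv); fold g in Huv.
    assert (Huv1 : IZR u * INR al + IZR v * INR be = 1).
    { apply (f_equal IZR) in Huv.
      rewrite plus_IZR, !mult_IZR, <- !INR_IZR_INZ in Huv.
      rewrite Hal, Hbe, !mult_INR in Huv.
      apply (Rmult_eq_reg_r (INR g)); auto; lra. }
    apply (f_equal INR) in Hal, Hbe; rewrite mult_INR in Hal, Hbe.
    pose (mc := fun i => INR (lval M i) / INR g').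
    assert (Hmc : forall i, (i < length M)%nat -> isZ (mc i)).
    { intros i Hi; unfold mc.
      destruct (fold_gcd_divide M (lval M i)) as [q Hq]; [now apply nth_In|].
      fold g' in Hq; rewrite Hq, mult_INR.
      replace (INR q * INR g' / INR g') with (INR q) by (field; auto).
      apply isZ_INR. }
    assert (Hmcf : forall x, form (length M) mc x = dot M x / INR g').
    { intros x; unfold dot, Rdiv; rewrite Rmult_comm; unfold form.
      rewrite <- rsum_scal; apply rsum_ext; intros i _; unfold mc; field; auto. }
    (* Extended by zero, because the coefficients must be integers at every index. *)
    pose (mz := fun i => if Nat.ltb i (length M) then mc i else 0).
    assert (Hmz : forall i, isZ (mz i)).
    { intros i; unfold mz; destruct (Nat.ltb_spec i (length M)); auto.
      apply (isZ_IZR 0). }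
    assert (Hmzf : forall x, form (length M) mz x = dot M x / INR g').
    { intros x; rewrite <- Hmcf; apply rsum_ext; intros i Hi; unfold mz.
      destruct (Nat.ltb_spec i (length M)); [auto|lia]. }
    (* Put z' = (M.x')/g' for the tail x' of x. The matrix with rows ([al], [be]) and (-v, u) has
       determinant one; it sends (x_0, z') to the normalized form of [a :: M] and to the new form
       [c' 0]. The forms of the tail follow, shifted by one. *)
    pose (c' := fun j i => match j, i with
                           | O, O => - IZR v
                           | O, S i => IZR u * mz i
                           | S _, O => 0
                           | S j, S i => c j i
                           end).
    assert (Hc'0 : forall x, form (S (length M)) (c' 0%nat) x =
              - IZR v * x 0%nat + IZR u * (dot M (fun i => x (S i)) / INR g')).
    { intros x; rewrite form_head, <- Hmzf; unfold form; rewrite <- rsum_scal.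
      cbn [c']; f_equal; apply rsum_ext; intros; ring. }
    assert (Hc'S : forall j x, form (S (length M)) (c' (S j)) x =
              form (length M) (c j) (fun i => x (S i))).
    { intros j x; rewrite form_head; cbn [c']; unfold form; ring. }
    exists c'; repeat split.
    + intros [|j] [|i]; cbn [c'].
      * rewrite <- opp_IZR; apply isZ_IZR.
      * apply isZ_mult; [apply isZ_IZR | auto].
      * apply (isZ_IZR 0).
      * auto.
    + intros x Hz Hy i Hi; change (length (b :: L)) with (length M) in *.
      set (z' := dot M (fun i => x (S i)) / INR g').
      assert (Hz1 : dot (a :: M) x / INR g = INR al * x 0%nat + INR be * z').
      { rewrite dot_cons, Hal.
        replace (dot M (fun i => x (S i))) with (INR be * INR g * z').
        2: { unfold z'; rewrite <- Hbe; field; auto. }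
        field; auto. }
      rewrite Hz1 in Hz.
      assert (Hy0 : isZ (- IZR v * x 0%nat + IZR u * z')).
      { unfold z'; rewrite <- Hc'0; apply Hy; cbn; lia. }
      destruct i as [|i].
      (* The inverse matrix, with rows (u, -be) and (v, al), recovers x_0 here and z' in the next
         case. *)
      * replace (x 0%nat) with
          (IZR u * (INR al * x 0%nat + INR be * z')
           - INR be * (- IZR v * x 0%nat + IZR u * z')).
        { apply isZ_minus; apply isZ_mult; auto using isZ_IZR, isZ_INR. }
        transitivity ((IZR u * INR al + IZR v * INR be) * x 0%nat); [ring|].
        rewrite Huv1; ring.
      * apply (Hint (fun i => x (S i))).
        { change (isZ z'); replace z' with
            (IZR v * (INR al * x 0%nat + INR be * z')
             + INR al * (- IZR v * x 0%nat + IZR u * z')).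
          { apply isZ_plus; apply isZ_mult; auto using isZ_IZR, isZ_INR. }
          transitivity ((IZR u * INR al + IZR v * INR be) * z'); [ring|].
          rewrite Huv1; ring. }
        { intros j Hj; change (S (length L)) with (length M).
          rewrite <- Hc'S; apply Hy; cbn; lia. }
        { cbn in Hi; lia. }
    + intros y z; change (length (b :: L)) with (length M) in *.
      (* The inverse matrix prescribes x_0 and z'; the induction hypothesis realizes this z' and the
         remaining values on the tail. *)
      destruct (Hsurj (fun j => y (S j)) (IZR v * z + INR al * y 0%nat))
        as (x' & Hx' & Hy').
      exists (fun i => match i with
                       | O => IZR u * z - INR be * y 0%nat
                       | S i => x' i
                       end).
      assert (Hd : dot M (fun i => x' i) / INR g' = IZR v * z + INR al * y 0%nat).
      { change (fun i => x' i) with x'; rewrite Hx'; fold g'; field; auto. }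
      split.
      * rewrite dot_cons; cbv beta iota.
        change (fun i => x' i) with x'; rewrite Hx'; fold g'.
        rewrite Hal, Hbe.
        transitivity (INR g * ((IZR u * INR al + IZR v * INR be) * z)); [ring|].
        rewrite Huv1; ring.
      * intros [|j] Hj.
        { rewrite Hc'0, Hd.
          transitivity ((IZR u * INR al + IZR v * INR be) * y 0%nat); [ring|].
          rewrite Huv1; ring. }
        { rewrite Hc'S; apply Hy'; cbn in Hj; lia. }
Qed.

Lemma dot_one (L : list nat) : dot L (fun _ => 1) = INR (list_sum L).
Proof.
  induction L as [|a L IH]; [reflexivity|].
  change (list_sum (a :: L)) with (a + list_sum L)%nat.
  rewrite dot_cons, IH, plus_INR; ring.
Qed.

(* The forms [c j] are coordinates on R^k / R(1,...,1) that identify the lattice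
   {x in Z^k | l.x in nZ} / Z(1,...,1) with Z^(k-1). *)
Lemma torus_coordinates (L : list nat) (k : nat) :
  (0 < k)%nat -> length L = k -> (forall b, In b L -> (0 < b)%nat) -> reduced L ->
  exists c : nat -> nat -> R,
    (forall x m, (forall i, (i < k)%nat -> isZ (x i)) ->
       dot L x = IZR m * INR (list_sum L) ->
       forall j, (j < k - 1)%nat -> isZ (form k (c j) x)) /\
    (forall j, form k (c j) (fun _ => 1) = 0) /\
    (forall x, (forall j, (j < k - 1)%nat -> isZ (form k (c j) x)) ->
       exists r, (forall i, (i < k)%nat -> isZ (x i - r)) /\
         dot L (fun i => x i - r) = 0) /\
    (forall y, exists x, forall j, (j < k - 1)%nat -> form k (c j) x = y j) /\
    (exists x, (forall i, (i < k)%nat -> isZ (x i)) /\ dot L x = 1).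
Proof.
  intros Hk HLk Hpos Hred.
  destruct L as [|a M]; [cbn in HLk; lia|].
  destruct (gcd_coordinates M a) as (c & Hc & Hint & Hsurj);
    [apply Hpos; left; auto | intros; apply Hpos; right; auto |].
  rewrite Hred in Hint, Hsurj; rewrite INR_1 in Hint, Hsurj.
  cbn [length] in HLk; rewrite HLk in Hint, Hsurj.
  replace (length M) with (k - 1)%nat in Hint, Hsurj by lia.
  assert (Ha : (0 < a)%nat) by (apply Hpos; left; auto).
  set (L := a :: M) in *; set (n := INR (list_sum L)).
  assert (Hn : n <> 0) by (apply not_0_INR; cbn; lia).
  pose (s := fun j => form k (c j) (fun _ => 1)).
  (* [dot L] takes the value n on (1,...,1), so subtracting s_j/n times it makes the forms vanish on
     the diagonal. *)
  pose (c' := fun j i => 1 * c j i + - (s j / n) * INR (lval L i)).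
  assert (Hc' : forall j x, form k (c' j) x = form k (c j) x - s j * (dot L x / n)).
  { intros j x; unfold c'; rewrite form_coef_combination; unfold dot.
    change (length L) with (S (length M)); rewrite HLk; field; auto. }
  assert (Hdc : forall x r, dot L (fun i => x i - r) = dot L x - r * n).
  { intros x r; unfold dot; rewrite form_minus, (form_const _ _ r).
    fold (dot L); fold (dot L x); fold (dot L (fun _ => 1)); now rewrite dot_one. }
  exists c'; repeat split.
  - intros x m Hx Hm j Hj; rewrite Hc', Hm; fold n.
    replace (IZR m * n / n) with (IZR m) by (field; auto).
    assert (isZ (s j)).
    { apply isZ_form; auto; intros; apply (isZ_IZR 1). }
    apply isZ_minus; [apply isZ_form; auto | apply isZ_mult; auto using isZ_IZR].
  - intros j; rewrite Hc', dot_one; fold n; unfold s; field; auto.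
  (* This shift moves x into the kernel of [dot L], where [c] and [c'] agree, so that [Hint]
     applies. *)
  - intros x Hx; exists (dot L x / n).
    assert (H0 : dot L (fun i => x i - dot L x / n) = 0).
    { rewrite Hdc; field; auto. }
    split; [|exact H0].
    intros i Hi.
    apply (Hint (fun i => x i - dot L x / n)); [| |lia].
    + rewrite H0; exists 0%Z; field.
    + intros j Hj; rewrite form_minus, form_const.
      replace (_ - _) with (form k (c' j) x); [apply Hx; lia|].
      rewrite Hc'; unfold s; ring.
  - intros y; destruct (Hsurj y 0) as (x & Hx0 & Hx).
    exists x; intros j Hj; rewrite Hc', Hx0, Hx by lia; field; auto.
  (* As the gcd is 1, [dot L] itself is one of the unimodular coordinates and may be given the value
     1 while the others are 0. *)
  - destruct (Hsurj (fun _ => 0) 1) as (x & Hx0 & Hx).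
    exists x; split; [|lra].
    intros i Hi; apply Hint; [| |lia].
    + rewrite Hx0; exists 1%Z; field.
    + intros j Hj; rewrite Hx by lia; apply (isZ_IZR 0).
Qed.

(** * Combinatorics of the simplices *)

Definition b2R (b : bool) : R := if b then 1 else 0.

Lemma b2R_bounds (b : bool) : 0 <= b2R b <= 1.
Proof. destruct b; cbn; lra. Qed.

Lemma isZ_b2R (b : bool) : isZ (b2R b).
Proof. destruct b; [exists 1%Z | exists 0%Z]; reflexivity. Qed.

(* An arbitrary subset when [r] is not a subset sum. *)
Definition subset_of (L : list nat) (r : nat) : nat -> bool :=
  epsilon (inhabits (fun _ => false)) (fun I => subsum L I = r).

Lemma subset_of_subsum (L : list nat) (I : nat -> bool) (i : nat) :
  generic L -> (i < length L)%nat -> subset_of L (subsum L I) i = I i.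
Proof.
  intros Hgen Hi; apply Hgen; [|exact Hi].
  unfold subset_of; apply epsilon_spec; now exists I.
Qed.

Lemma INR_list_sum (l : list nat) : INR (list_sum l) = fold_right Rplus 0 (map INR l).
Proof.
  induction l as [|a l IH]; [reflexivity|].
  change (list_sum (a :: l)) with (a + list_sum l)%nat.
  rewrite plus_INR, IH; reflexivity.
Qed.

Lemma INR_subsum (L : list nat) (I : nat -> bool) :
  INR (subsum L I) = dot L (fun i => b2R (I i)).
Proof.
  unfold subsum; rewrite INR_list_sum, map_map; apply rsum_ext.
  intros i _; destruct (I i); cbn [b2R]; [ring | rewrite INR_0; ring].
Qed.

(** The set of steps taken before the j-th vertex of a simplex, as a characteristic function so that
    it can be compared with [subset_of]. *)
Definition prefix (s : list nat) (j i : nat) : bool :=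
  if in_dec Nat.eq_dec i (firstn j s) then true else false.

Lemma list_sum_map_const_0 (A : Type) (F : A -> nat) (l : list A) :
  (forall i, In i l -> F i = 0%nat) -> list_sum (map F l) = 0%nat.
Proof.
  induction l as [|a l IH]; intros H; [reflexivity|].
  change (F a + list_sum (map F l) = 0)%nat.
  rewrite (H a) by (left; auto); rewrite IH; auto; intros; apply H; right; auto.
Qed.

(** * Partial sums along a permutation *)

Section Permutations.

Context (L s : list nat) (Hs : Permutation s (seq 0 (length L))).

Lemma perm_length : length s = length L.
Proof. now rewrite (Permutation_length Hs), length_seq. Qed.

Lemma perm_NoDup : NoDup s.
Proof. apply (Permutation_NoDup (Permutation_sym Hs)), seq_NoDup. Qed.

Lemma perm_nth_lt (m : nat) : (m < length L)%nat -> (nth m s 0 < length L)%nat.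
Proof.
  intros Hm.
  assert (H : In (nth m s 0%nat) s) by (apply nth_In; rewrite perm_length; auto).
  apply (Permutation_in _ Hs), in_seq in H; lia.
Qed.

Lemma perm_nth_surj (i : nat) :
  (i < length L)%nat -> exists m, (m < length L)%nat /\ nth m s 0%nat = i.
Proof.
  intros Hi.
  assert (H : In i s).
  { apply (Permutation_in _ (Permutation_sym Hs)), in_seq; lia. }
  destruct (In_nth s i 0%nat H) as (m & Hm & He).
  exists m; rewrite <- perm_length; auto.
Qed.

Lemma prefix_nth (j m : nat) :
  (m < length L)%nat -> prefix s j (nth m s 0%nat) = Nat.ltb m j.
Proof.
  rewrite <- perm_length; intros Hm; unfold prefix.
  destruct (in_dec _ _ _) as [Hin|Hin]; destruct (Nat.ltb_spec m j) as [Hj|Hj]; auto.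
  - exfalso; destruct (In_nth _ _ 0%nat Hin) as (m' & Hm' & He).
    rewrite length_firstn in Hm'.
    rewrite nth_firstn in He; destruct (Nat.ltb_spec m' j); [|lia].
    enough (m' = m) by lia.
    apply (proj1 (NoDup_nth s 0%nat) perm_NoDup); auto; lia.
  - exfalso; apply Hin.
    replace (nth m s 0%nat) with (nth m (firstn j s) 0%nat).
    + apply nth_In; rewrite length_firstn; lia.
    + rewrite nth_firstn; destruct (Nat.ltb_spec m j); [auto|lia].
Qed.

(** Reorder the sum along [s]: the entries after position j lie outside the prefix because [s] has
    no repetition. *)
Lemma psum_subsum (j : nat) : psum L s j = subsum L (prefix s j).
Proof.
  unfold psum, subsum.
  rewrite <- (Permutation_list_sum (Permutation_map _ Hs)).
  rewrite <- (firstn_skipn j s) at 2.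
  rewrite map_app, list_sum_app.
  rewrite (list_sum_map_const_0 _ _ (skipn j s)).
  - rewrite Nat.add_0_r; f_equal; apply map_ext_in.
    intros i Hi; unfold prefix; destruct (in_dec _ _ _); tauto.
  - intros i Hi; unfold prefix; destruct (in_dec _ _ _) as [Hf|]; auto.
    pose proof perm_NoDup as Hnd; rewrite <- (firstn_skipn j s) in Hnd.
    exfalso; revert Hf Hi; generalize (firstn j s) (skipn j s) Hnd; clear.
    intros l l' Hnd H H'; induction l as [|a l IH]; [easy|].
    cbn in Hnd; inversion Hnd as [|? ? Hn Hd]; subst.
    destruct H as [->|H]; [apply Hn, in_or_app; auto | auto].
Qed.

Lemma INR_psum (j : nat) : INR (psum L s j) = dot L (fun i => b2R (prefix s j i)).
Proof. rewrite psum_subsum; apply INR_subsum. Qed.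

Lemma psum_lt (u w : nat) :
  (forall i, (i < length L)%nat -> (0 < lval L i)%nat) ->
  (u < w <= length L)%nat -> (psum L s u < psum L s w)%nat.
Proof.
  intros Hpos Huw; apply INR_lt; rewrite !INR_psum; apply Rlt_0_minus.
  unfold dot; rewrite <- form_minus.
  assert (Hm : (u < length L)%nat) by lia.
  pose proof (perm_nth_lt u Hm) as Hl.
  set (F := fun i => INR (lval L i) * (b2R (prefix s w i) - b2R (prefix s u i))).
  apply Rlt_le_trans with (F (nth u s 0%nat)).
  - unfold F; rewrite !prefix_nth by auto.
    rewrite (proj2 (Nat.ltb_lt u w)), Nat.ltb_irrefl by lia; cbn [b2R].
    rewrite Rminus_0_r, Rmult_1_r; apply lt_0_INR, Hpos, Hl.
  - apply (rsum_term_le (length L) _ F); [|exact Hl].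
    intros i Hi; unfold F; apply Rmult_le_pos; [apply pos_INR|].
    destruct (perm_nth_surj i Hi) as (m & Hml & <-).
    rewrite !prefix_nth by auto.
    destruct (Nat.ltb_spec m w), (Nat.ltb_spec m u); cbn [b2R]; lra || lia.
Qed.

Lemma psum_full : psum L s (length L) = list_sum L.
Proof.
  apply INR_eq; rewrite INR_psum, <- dot_one; apply form_ext.
  intros i Hi; destruct (perm_nth_surj i Hi) as (m & Hm & <-).
  rewrite prefix_nth by auto; now rewrite (proj2 (Nat.ltb_lt _ _) Hm).
Qed.

Lemma psum_zero : psum L s 0 = 0%nat.
Proof. reflexivity. Qed.

End Permutations.

(** The expression reduced on the left is congruent to [r] and lies strictly between 0 and 2n, so it
    is r or r + n. *)
Lemma mod_difference (n x a b r : nat) :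
  (r < n)%nat -> (r + b = a \/ r + b = a + n)%nat ->
  (((x + a) mod n + n - (x + b) mod n) mod n)%nat = r.
Proof.
  intros Hr Hab.
  pose proof (Nat.div_mod_eq (x + a) n) as Ha.
  pose proof (Nat.div_mod_eq (x + b) n) as Hb.
  pose proof (Nat.mod_upper_bound (x + a) n ltac:(lia)).
  pose proof (Nat.mod_upper_bound (x + b) n ltac:(lia)).
  set (ra := ((x + a) mod n)%nat) in *; set (rb := ((x + b) mod n)%nat) in *.
  set (qa := ((x + a) / n)%nat) in *; set (qb := ((x + b) / n)%nat) in *.
  assert (Ht : (exists t, (t <= 1)%nat /\ ra + n - rb = r + t * n)%nat).
  { destruct Hab as [Hab|Hab].
    - destruct (Nat.lt_trichotomy (qb + 1) qa) as [|[|]]; [nia| |].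
      + exists 0%nat; nia.
      + destruct (Nat.eq_dec qb qa); [exists 1%nat; nia | nia].
    - destruct (Nat.lt_trichotomy qb qa) as [|[|]]; [nia| |].
      + exists 0%nat; nia.
      + destruct (Nat.eq_dec qb (qa + 1)); [exists 1%nat; nia | nia]. }
  destruct Ht as (t & _ & ->).
  rewrite Nat.Div0.mod_add; now apply Nat.mod_small.
Qed.

(** Going forward from vertex [w] to vertex [u] takes the steps between them or, if [u] precedes
    [w], all the other steps, a full turn adding n to the sum and 1 to every coordinate. The sum of
    these steps is below n, hence equals the residue, and genericity recovers the set from it. *)
Lemma vertex_difference (L s : list nat) (n x u w i : nat) :
  Permutation s (seq 0 (length L)) -> generic L ->
  (forall i, (i < length L)%nat -> (0 < lval L i)%nat) -> list_sum L = n ->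
  (u < length L)%nat -> (w < length L)%nat -> (i < length L)%nat ->
  b2R (subset_of L (((x + psum L s u) mod n + n - (x + psum L s w) mod n) mod n) i) =
  b2R (prefix s u i) - b2R (prefix s w i) + b2R (Nat.ltb u w).
Proof.
  intros Hs Hgen Hpos Hn Hu Hw Hi.
  pose (I := fun i => if Nat.ltb u w
                      then negb (prefix s w i && negb (prefix s u i))
                      else (prefix s u i && negb (prefix s w i))%bool).
  assert (HI : forall i, (i < length L)%nat -> b2R (I i) =
            b2R (prefix s u i) - b2R (prefix s w i) + b2R (Nat.ltb u w)).
  { intros i' Hi'; destruct (perm_nth_surj L s Hs i' Hi') as (m & Hm & <-).
    unfold I; rewrite !(prefix_nth L s Hs) by auto.
    destruct (Nat.ltb_spec u w), (Nat.ltb_spec m u), (Nat.ltb_spec m w);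
      cbn [b2R negb andb]; lra || lia. }
  assert (Hsum : INR (subsum L I) = INR (psum L s u) - INR (psum L s w)
                                    + b2R (Nat.ltb u w) * INR n).
  { rewrite INR_subsum, !(INR_psum L s Hs), <- Hn, <- dot_one; unfold dot.
    rewrite <- form_minus, <- form_scal, <- form_plus.
    apply form_ext; intros i' Hi'; rewrite HI by auto; ring. }
  assert (Hsum' : (subsum L I + psum L s w
                   = psum L s u + if Nat.ltb u w then n else 0)%nat).
  { apply INR_eq; rewrite !plus_INR, Hsum.
    destruct (Nat.ltb u w); cbn [b2R]; rewrite ?INR_0; ring. }
  assert (psum L s u < n)%nat.
  { rewrite <- Hn, <- (psum_full L s Hs); apply psum_lt; auto; lia. }
  assert (Hr : (subsum L I < n)%nat).
  { destruct (Nat.ltb_spec u w); [|lia].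
    assert (psum L s u < psum L s w)%nat by (apply psum_lt; auto; lia); lia. }
  rewrite (mod_difference n x _ _ (subsum L I) Hr).
  - rewrite subset_of_subsum by auto; now apply HI.
  - destruct (Nat.ltb u w); lia.
Qed.

Lemma in_tonn_max_simplex (n : nat) (L : list nat) (x : nat) (s : list nat) (v : nat) :
  In v (tonn_max_simplex n L x s) <->
  exists j, (j < length L)%nat /\ v = ((x + psum L s j) mod n)%nat.
Proof.
  unfold tonn_max_simplex; rewrite in_map_iff; split.
  - intros (j & <- & Hj); apply in_seq in Hj; exists j; split; [lia|auto].
  - intros (j & Hj & ->); exists j; split; [auto | apply in_seq; lia].
Qed.

(** The indicator keeps the gaps from index [m] on. This evaluates, coordinate by coordinate, the
    convex combination whose weights are successive gaps of a sorted sequence. *)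
Lemma rsum_telescope (d m : nat) (rho : nat -> R) :
  (m <= d)%nat ->
  rsum d (fun j => (rho j - rho (S j)) * b2R (Nat.ltb m (S j))) = rho m - rho d.
Proof.
  revert m rho; induction d as [|d IH]; intros m rho Hm.
  - rewrite rsum_0; replace m with 0%nat by lia; ring.
  - rewrite rsum_head; destruct m as [|m].
    + specialize (IH 0%nat (fun j => rho (S j)) ltac:(lia)).
      cbn [Nat.ltb Nat.leb b2R] in *; rewrite IH; ring.
    + specialize (IH m (fun j => rho (S j)) ltac:(lia)).
      cbn [Nat.ltb Nat.leb b2R] in *; rewrite IH; ring.
Qed.

(** Change of variables for the weights [t] pushed forward along [vt]: exchange the two sums. *)
Lemma rsum_pushforward (n k : nat) (t : nat -> R) (vt : nat -> nat) (F : nat -> R) :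
  (forall j, (vt j < n)%nat) ->
  rsum n (fun v => rsum k (fun j => t j * b2R (Nat.eqb v (vt j))) * F v) =
  rsum k (fun j => t j * F (vt j)).
Proof.
  intros Hvt.
  rewrite (rsum_ext n _ (fun v => rsum k (fun j =>
    t j * (if Nat.eqb v (vt j) then F v else 0)))).
  - rewrite rsum_swap; apply rsum_ext; intros j _.
    now rewrite rsum_scal, (rsum_delta n (vt j) F).
  - intros v _; rewrite Rmult_comm, <- rsum_scal; apply rsum_ext; intros j _.
    destruct (Nat.eqb v (vt j)); cbn; ring.
Qed.

(** Insertion sort, decreasing in [r]. *)
Lemma exists_sorted (r : nat -> R) (l : list nat) :
  exists s, Permutation s l /\
    forall m, (S m < length s)%nat -> r (nth (S m) s 0%nat) <= r (nth m s 0%nat).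
Proof.
  enough (H : exists s, Permutation s l /\ StronglySorted (fun a b => r b <= r a) s).
  { destruct H as (s & Hs & Hsort); exists s; split; [exact Hs|].
    clear Hs; induction Hsort as [|a s Hsort IH Hall]; cbn [length]; [lia|].
    intros [|m] Hm; [|apply IH; lia].
    rewrite Forall_forall in Hall; cbn [nth]; apply Hall, nth_In; lia. }
  induction l as [|a l (s & Hs & Hsort)].
  - exists []; split; constructor.
  - enough (H : exists s', Permutation s' (a :: s) /\
                  StronglySorted (fun a b => r b <= r a) s').
    { destruct H as (s' & Hs' & Hsort'); exists s'; split; [|exact Hsort'].
      now rewrite Hs', Hs. }
    clear Hs; induction Hsort as [|b s Hsort (s' & Hs' & Hsort') Hall].
    { exists [a]; split; repeat constructor. }
    destruct (Rle_lt_dec (r b) (r a)) as [Hba|Hab].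
    + exists (a :: b :: s); split; [reflexivity|].
      constructor; [now constructor|]; constructor; [exact Hba|].
      eapply Forall_impl; [|exact Hall]; cbn; intros; lra.
    + exists (b :: s'); split.
      { rewrite Hs'; apply perm_swap. }
      constructor; [exact Hsort'|].
      rewrite Hs'; constructor; [lra | exact Hall].
Qed.

(** An integer sequence that never increases and loses at most 1 overall can drop only once. Read
    along a permutation, it is a constant plus the indicator of a prefix, that is, a vertex of the
    simplex. *)
Lemma single_drop (k : nat) (d : nat -> Z) :
  (forall m m', (m <= m' < k)%nat -> (0 <= d m - d m' <= 1)%Z) ->
  (forall m, (m < k)%nat -> d m = d 0%nat) \/
  exists m, (0 < m < k)%nat /\ (forall j, (j < m)%nat -> d j = d 0%nat) /\
    (forall j, (m <= j < k)%nat -> d j = (d 0%nat - 1)%Z).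
Proof.
  induction k as [|k IH]; intros Hd; [left; lia|].
  destruct IH as [H|(m & Hm & Hlow & Hhigh)].
  - intros; apply Hd; lia.
  - destruct (Z.eq_dec (d k) (d 0%nat)) as [He|He].
    + left; intros m Hm; destruct (Nat.eq_dec m k) as [->|]; [auto | apply H; lia].
    + right; exists k; pose proof (Hd 0%nat k ltac:(lia)).
      assert (k <> 0%nat) by (intros ->; auto).
      repeat split; try lia; [exact H|].
      intros j Hj; replace j with k by lia; lia.
  - right; exists m; repeat split; try lia; [exact Hlow|].
    intros j Hj; destruct (Nat.eq_dec j k) as [->|]; [|apply Hhigh; lia].
    pose proof (Hd 0%nat k ltac:(lia)); pose proof (Hd m k ltac:(lia)).
    pose proof (Hhigh m ltac:(lia)); lia.
Qed.

(** * Points of the torus *)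

Lemma cos_sin_eq_of_isZ (a b : R) :
  isZ (a - b) ->
  cos (2 * PI * a) = cos (2 * PI * b) /\ sin (2 * PI * a) = sin (2 * PI * b).
Proof.
  intros [z Hz].
  assert (Hs : sin (IZR z * PI) = 0) by (apply sin_eq_0_1; now exists z).
  replace (2 * PI * a) with (2 * PI * b + 2 * (IZR z * PI)) by (rewrite <- Hz; ring).
  rewrite cos_plus, sin_plus, cos_2a_sin, sin_2a, Hs; split; ring.
Qed.

(** The cosine of the difference of the angles is 1, so the sine of half that difference
    vanishes. *)
Lemma isZ_of_cos_sin_eq (a b : R) :
  cos (2 * PI * a) = cos (2 * PI * b) -> sin (2 * PI * a) = sin (2 * PI * b) ->
  isZ (a - b).
Proof.
  intros Hc Hs.
  assert (H1 : cos (2 * (PI * (a - b))) = 1).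
  { replace (2 * (PI * (a - b))) with (2 * PI * a - 2 * PI * b) by ring.
    rewrite cos_minus, Hc, Hs; pose proof (sin2_cos2 (2 * PI * b)) as H.
    unfold Rsqr in H; lra. }
  rewrite cos_2a_sin in H1.
  assert (H0 : sin (PI * (a - b)) = 0) by nra.
  destruct (sin_eq_0_0 _ H0) as [z Hz]; exists z.
  apply (Rmult_eq_reg_l PI); [lra | apply PI_neq0].
Qed.

Lemma circle_angle (c s : R) :
  c ^ 2 + s ^ 2 = 1 -> exists y, cos (2 * PI * y) = c /\ sin (2 * PI * y) = s.
Proof.
  intros H; assert (Hc : -1 <= c <= 1) by nra.
  assert (HPI := PI_neq0).
  assert (Hsq : sqrt (1 - c²) = Rabs s).
  { rewrite <- sqrt_Rsqr_abs; f_equal; unfold Rsqr; lra. }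
  destruct (Rle_lt_dec 0 s) as [Hs|Hs].
  - exists (acos c / (2 * PI)).
    replace (2 * PI * (acos c / (2 * PI))) with (acos c) by (field; auto).
    rewrite cos_acos, sin_acos, Hsq, Rabs_right by lra; auto.
  - exists (- acos c / (2 * PI)).
    replace (2 * PI * (- acos c / (2 * PI))) with (- acos c) by (field; auto).
    rewrite cos_neg, sin_neg, cos_acos, sin_acos, Hsq, Rabs_left by lra; lra.
Qed.

Lemma Rabs_sin_le (x : R) : Rabs (sin x) <= Rabs x.
Proof.
  assert (Hpos : forall x, 0 < x -> Rabs (sin x) <= x).
  { clear x; intros x Hx; destruct (Rle_lt_dec 1 x) as [H1|H1].
    - pose proof (SIN_bound x); apply Rabs_le; lra.
    - pose proof PI2_1; rewrite Rabs_right.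
      + pose proof (sin_lt_x x Hx); lra.
      + apply Rle_ge, sin_ge_0; lra. }
  destruct (Rtotal_order x 0) as [H|[->|H]].
  - pose proof (Hpos (- x) ltac:(lra)) as H'; rewrite sin_neg, Rabs_Ropp in H'.
    now rewrite (Rabs_left x) by lra.
  - rewrite sin_0; lra.
  - rewrite (Rabs_right x) by lra; auto.
Qed.

Lemma Rabs_sin_diff_le (x y : R) : Rabs (sin x - sin y) <= Rabs (x - y).
Proof.
  rewrite form4, !Rabs_mult, (Rabs_right 2) by lra.
  pose proof (Rabs_sin_le ((x - y) / 2)) as H1.
  assert (H2 : Rabs (cos ((x + y) / 2)) <= 1) by (apply Rabs_le, COS_bound).
  unfold Rdiv in H1 at 2; rewrite Rabs_mult, (Rabs_right (/ 2)) in H1 by lra.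
  pose proof (Rabs_pos (sin ((x - y) / 2))); pose proof (Rabs_pos (cos ((x + y) / 2))).
  nra.
Qed.

Lemma Rabs_cos_diff_le (x y : R) : Rabs (cos x - cos y) <= Rabs (x - y).
Proof.
  rewrite !cos_sin.
  replace (x - y) with ((PI / 2 + x) - (PI / 2 + y)) by ring; apply Rabs_sin_diff_le.
Qed.

(** Angles are counted in turns, so that integral translates of [y] give the same point. *)
Definition torus_point (d : nat) (y : nat -> R) (t : nat) : R :=
  if Nat.ltb t (2 * d)
  then if Nat.even t then cos (2 * PI * y (Nat.div2 t))
       else sin (2 * PI * y (Nat.div2 t))
  else 0.

Lemma torus_point_even (d : nat) (y : nat -> R) (j : nat) :
  (j < d)%nat -> torus_point d y (2 * j) = cos (2 * PI * y j).
Proof.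
  intros Hj; unfold torus_point.
  rewrite (proj2 (Nat.ltb_lt _ _)), Nat.even_even, Nat.div2_double by lia; auto.
Qed.

Lemma torus_point_odd (d : nat) (y : nat -> R) (j : nat) :
  (j < d)%nat -> torus_point d y (2 * j + 1) = sin (2 * PI * y j).
Proof.
  intros Hj; unfold torus_point.
  rewrite (proj2 (Nat.ltb_lt _ _)), Nat.even_odd by lia.
  now rewrite Nat.add_1_r, Nat.div2_succ_double.
Qed.

Lemma torus_point_high (d : nat) (y : nat -> R) (t : nat) :
  (2 * d <= t)%nat -> torus_point d y t = 0.
Proof.
  intros Ht; unfold torus_point; destruct (Nat.ltb_spec t (2 * d)); [lia|auto].
Qed.

Lemma torus_index (d : nat) (Q : nat -> Prop) :
  (forall j, (j < d)%nat -> Q (2 * j)%nat) ->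
  (forall j, (j < d)%nat -> Q (2 * j + 1)%nat) ->
  forall t, (t < 2 * d)%nat -> Q t.
Proof.
  intros H0 H1 t Ht; destruct (Nat.Even_or_Odd t) as [[j ->]|[j ->]];
    [apply H0 | apply H1]; lia.
Qed.

Lemma torus_torus_point (d : nat) (y : nat -> R) : torus d (torus_point d y).
Proof.
  split.
  - intros i Hi; rewrite torus_point_even, torus_point_odd by auto.
    pose proof (sin2_cos2 (2 * PI * y i)) as H; unfold Rsqr in H; lra.
  - apply torus_point_high.
Qed.

Lemma torus_point_ext (d : nat) (y y' : nat -> R) :
  (forall j, (j < d)%nat -> isZ (y j - y' j)) ->
  forall t, torus_point d y t = torus_point d y' t.
Proof.
  intros H t; destruct (Nat.lt_ge_cases t (2 * d)) as [Ht|Ht].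
  - revert t Ht; apply torus_index; intros j Hj.
    + rewrite !torus_point_even by auto; now apply cos_sin_eq_of_isZ, H.
    + rewrite !torus_point_odd by auto; now apply cos_sin_eq_of_isZ, H.
  - now rewrite !torus_point_high.
Qed.

Lemma torus_point_inj (d : nat) (y y' : nat -> R) :
  (forall t, torus_point d y t = torus_point d y' t) ->
  forall j, (j < d)%nat -> isZ (y j - y' j).
Proof.
  intros H j Hj; apply isZ_of_cos_sin_eq.
  - rewrite <- !(torus_point_even d) by auto; apply H.
  - rewrite <- !(torus_point_odd d) by auto; apply H.
Qed.

Lemma torus_point_surj (d : nat) (q : nat -> R) :
  torus d q -> exists y, forall t, torus_point d y t = q t.
Proof.
  intros [Hq Hq0].
  destruct (choice (fun j y => (j < d)%nat ->
    cos (2 * PI * y) = q (2 * j)%nat /\ sin (2 * PI * y) = q (2 * j + 1)%nat))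
    as [y Hy].
  { intros j; destruct (Nat.lt_ge_cases j d) as [Hj|Hj].
    - destruct (circle_angle _ _ (Hq j Hj)) as [y Hy]; exists y; auto.
    - exists 0; lia. }
  exists y; intros t; destruct (Nat.lt_ge_cases t (2 * d)) as [Ht|Ht].
  - revert t Ht; apply torus_index; intros j Hj.
    + rewrite torus_point_even by auto; now apply Hy.
    + rewrite torus_point_odd by auto; now apply Hy.
  - rewrite torus_point_high by auto; symmetry; auto.
Qed.

Lemma torus_point_lipschitz (d : nat) (y y' : nat -> R) (r : R) :
  (forall j, (j < d)%nat -> Rabs (y j - y' j) <= r) ->
  forall t, (t < 2 * d)%nat ->
  Rabs (torus_point d y t - torus_point d y' t) <= 2 * PI * r.
Proof.
  intros H.
  assert (Hs : forall j, (j < d)%nat ->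
                 Rabs (2 * PI * y j - 2 * PI * y' j) <= 2 * PI * r).
  { intros j Hj; pose proof PI_RGT_0.
    rewrite <- Rmult_minus_distr_l, Rabs_mult, (Rabs_right (2 * PI)) by lra.
    apply Rmult_le_compat_l; [lra | auto]. }
  apply torus_index; intros j Hj.
  - rewrite !torus_point_even by auto.
    eapply Rle_trans; [apply Rabs_cos_diff_le | auto].
  - rewrite !torus_point_odd by auto.
    eapply Rle_trans; [apply Rabs_sin_diff_le | auto].
Qed.

(** * Closedness of the geometric realization *)

Lemma tonn_realization_closed (n : nat) (L : list nat) (u : nat -> nat -> R)
    (p : nat -> R) :
  (forall m, tonn_realization n L (u m)) ->
  (forall i, Un_cv (fun m => u m i) (p i)) ->
  tonn_realization n L p.
Proof.
  intros Hu Hcv.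
  assert (Hge : forall i, 0 <= p i).
  { intros i; apply Rnot_lt_le; intros Hlt.
    destruct (Hcv i (- p i)) as [N HN]; [lra|].
    specialize (HN N (le_n N)); unfold Rdist in HN.
    apply Rabs_def2 in HN; pose proof (proj1 (Hu N) i); lra. }
  repeat split.
  - exact Hge.
  - intros v Hv; apply (UL_sequence (fun m => u m v)); [apply Hcv|].
    intros e He; exists 0%nat; intros m _; unfold Rdist.
    rewrite (proj1 (proj2 (Hu m)) v Hv), Rminus_diag, Rabs_R0; exact He.
  - change (rsum n p = 1); apply (UL_sequence (fun m => rsum n (u m))).
    + clear Hu Hge; revert u p Hcv; induction n as [|d IH]; intros u p Hcv.
      * intros e He; exists 0%nat; intros m _; unfold Rdist.
        rewrite !rsum_0, Rminus_diag, Rabs_R0; exact He.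
      * rewrite rsum_head; apply Un_cv_ext with
          (fun m => u m 0%nat + rsum d (fun i => u m (S i))).
        { intros m; now rewrite rsum_head. }
        apply CV_plus; [apply Hcv | apply (IH (fun m i => u m (S i)))].
        intros i; apply Hcv.
    + intros e He; exists 0%nat; intros m _; unfold Rdist, rsum.
      rewrite (proj1 (proj2 (proj2 (Hu m)))), Rminus_diag, Rabs_R0; exact He.
  (* A coordinate that is nonzero in the limit is nonzero from some rank on. A common rank [N] for
     all n coordinates makes the simplex carrying [u N] carry [p] too. *)
  - destruct (uniform_rank n (fun v m => p v <> 0 -> u m v <> 0)) as [N HN].
    { intros v _; destruct (Req_dec (p v) 0) as [H0|H0].
      - exists 0%nat; tauto.
      - destruct (Hcv v (p v)) as [N HN]; [specialize (Hge v); lra|].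
        exists N; intros m Hm _ Hz; specialize (HN m Hm); unfold Rdist in HN.
        rewrite Hz in HN; apply Rabs_def2 in HN; lra. }
    destruct (Hu N) as (_ & H0 & _ & x & s & Hx & Hs & Hsupp).
    exists x, s; repeat split; auto; intros v Hv; apply Hsupp.
    destruct (Nat.lt_ge_cases v n) as [Hvn|Hvn]; [apply HN; auto|].
    exfalso; apply Hv, (UL_sequence (fun m => u m v)); [apply Hcv|].
    intros e He; exists 0%nat; intros m _; unfold Rdist.
    rewrite (proj1 (proj2 (Hu m)) v Hvn), Rminus_diag, Rabs_R0; exact He.
Qed.

(** * The lift to R^k and the induced map to the torus *)

Definition supported (n : nat) (L : list nat) (p : nat -> R) (x : nat) (s : list nat)
  : Prop := forall v, p v <> 0 -> In v (tonn_max_simplex n L x s).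

(* The point of R^k with barycentric coordinates [p], the vertex [v] being lifted
   to [b X] plus the indicator vector of the set of steps leading from [b] to [v]. *)
Definition lift (n : nat) (L : list nat) (X : nat -> R) (b : nat) (p : nat -> R)
    (i : nat) : R :=
  INR b * X i + rsum n (fun v => p v * b2R (subset_of L ((v + n - b) mod n) i)).

(** By [vertex_difference], replacing the base changes the step set of every vertex by the same
    difference of prefixes, up to a multiple of (1,...,1) depending on the vertex. *)
Lemma lift_base_change (n : nat) (L : list nat) (X p : nat -> R) (x : nat)
    (s : list nat) (b b' : nat) :
  generic L -> (forall i, (i < length L)%nat -> (0 < lval L i)%nat) ->
  list_sum L = n -> Permutation s (seq 0 (length L)) ->
  (forall i, (i < length L)%nat -> isZ (X i)) -> dot L X = 1 ->
  rsum n p = 1 -> supported n L p x s ->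
  In b (tonn_max_simplex n L x s) -> In b' (tonn_max_simplex n L x s) ->
  exists z m r, (forall i, (i < length L)%nat -> isZ (z i)) /\
    dot L z = IZR m * INR n /\
    forall i, (i < length L)%nat -> lift n L X b' p i = lift n L X b p i + z i + r.
Proof.
  intros Hgen Hpos Hn Hs HXZ HX Hp Hsupp Hb Hb'.
  apply in_tonn_max_simplex in Hb, Hb'.
  destruct Hb as (u & Hu & Hb), Hb' as (w & Hw & Hb').
  (* [e v] is the part of the change that does not depend on the coordinate i; summed over v it
     becomes the constant [r]. *)
  destruct (choice (fun v e => forall i, (i < length L)%nat ->
      p v * b2R (subset_of L ((v + n - b') mod n) i) =
      p v * b2R (subset_of L ((v + n - b) mod n) i)
      + (b2R (prefix s u i) - b2R (prefix s w i)) * p v + e)) as [e He].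
  { intros v; destruct (Req_dec (p v) 0) as [H0|H0].
    - exists 0; intros i _; rewrite H0; ring.
    - apply Hsupp, in_tonn_max_simplex in H0; destruct H0 as (j & Hj & Hv).
      exists (p v * (b2R (Nat.ltb j w) - b2R (Nat.ltb j u))); intros i Hi.
      rewrite Hb, Hb', Hv, !(vertex_difference L s n x) by auto; ring. }
  exists (fun i => (INR b' - INR b) * X i + (b2R (prefix s u i) - b2R (prefix s w i))).
  (* The multiple of n is the difference of the quotients discarded when the two vertices are
     reduced mod n. *)
  exists (Z.of_nat ((x + psum L s u) / n) - Z.of_nat ((x + psum L s w) / n))%Z, (rsum n e).
  repeat split.
  - intros i Hi; apply isZ_plus; [apply isZ_mult; auto|]; apply isZ_minus;
      auto using isZ_INR, isZ_b2R.
  - unfold dot; rewrite form_plus, form_minus, form_scal; fold (dot L).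
    fold (dot L X) (dot L (fun i => b2R (prefix s u i)))
      (dot L (fun i => b2R (prefix s w i))).
    rewrite <- !(INR_psum L s Hs), HX, minus_IZR, <- !INR_IZR_INZ.
    pose proof (f_equal INR (Nat.div_mod_eq (x + psum L s u) n)) as E1.
    pose proof (f_equal INR (Nat.div_mod_eq (x + psum L s w) n)) as E2.
    rewrite <- Hb, !plus_INR, mult_INR in E1.
    rewrite <- Hb', !plus_INR, mult_INR in E2; lra.
  - intros i Hi; unfold lift.
    rewrite (rsum_ext n _ _ (fun v _ => He v i Hi)), !rsum_plus, rsum_scal, Hp; ring.
Qed.

Definition angle (n k : nat) (L : list nat) (c : nat -> nat -> R) (X : nat -> R)
    (b : nat) (p : nat -> R) (j : nat) : R :=
  form k (c j) (lift n L X b p).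

(** The base is any vertex in the support of [p]; by [torus_map_base] every vertex of a carrying
    simplex gives the same point. *)
Definition torus_map (n k : nat) (L : list nat) (c : nat -> nat -> R) (X : nat -> R)
    (p : nat -> R) : nat -> R :=
  torus_point (k - 1)
    (angle n k L c X (epsilon (inhabits 0%nat) (fun b => p b <> 0)) p).

(** For a fixed base the angles are affine in [p], with coefficients independent of the simplex
    carrying [p]; this yields continuity across simplices. *)
Lemma angle_affine (n k : nat) (L : list nat) (c : nat -> nat -> R) (X : nat -> R)
    (b : nat) (p : nat -> R) (j : nat) :
  angle n k L c X b p j = INR b * form k (c j) X +
    rsum n (fun v => form k (c j)
      (fun i => b2R (subset_of L ((v + n - b) mod n) i)) * p v).
Proof.
  unfold angle, lift; rewrite form_plus, form_scal; f_equal; unfold form.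
  rewrite (rsum_ext k _ (fun i => rsum n (fun v =>
    c j i * (p v * b2R (subset_of L ((v + n - b) mod n) i)))))
    by (intros; now rewrite rsum_scal).
  rewrite rsum_swap; apply rsum_ext; intros v _.
  rewrite Rmult_comm, <- rsum_scal; apply rsum_ext; intros; ring.
Qed.

(** * Well-definedness and continuity of the map to the torus *)

Section Tonnetz.

Context (n k : nat) (L : list nat) (c : nat -> nat -> R) (X : nat -> R).
Context (Hk : (2 <= k)%nat) (HL : length L = k)
  (Hpos : forall i, (i < k)%nat -> (0 < lval L i)%nat)
  (Hn : list_sum L = n) (Hgen : generic L)
  (HcZ : forall x m, (forall i, (i < k)%nat -> isZ (x i)) ->
     dot L x = IZR m * INR n ->
     forall j, (j < k - 1)%nat -> isZ (form k (c j) x))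
  (Hc1 : forall j, form k (c j) (fun _ => 1) = 0)
  (HXZ : forall i, (i < k)%nat -> isZ (X i)) (HX : dot L X = 1).

(** The lattice part of the change has integral coordinates by [HcZ], and the constant part is
    killed by [Hc1]. *)
Lemma angle_base_change (p : nat -> R) (x : nat) (s : list nat) (b b' : nat) :
  Permutation s (seq 0 (length L)) -> rsum n p = 1 -> supported n L p x s ->
  In b (tonn_max_simplex n L x s) -> In b' (tonn_max_simplex n L x s) ->
  forall j, (j < k - 1)%nat ->
  isZ (angle n k L c X b' p j - angle n k L c X b p j).
Proof.
  intros Hs Hp Hsupp Hb Hb' j Hj.
  destruct (lift_base_change n L X p x s b b') as (z & m & r & Hz & Hm & Heq);
    try rewrite HL; auto; try (rewrite HL in *; auto).
  unfold angle; rewrite (form_ext k _ _ _ Heq).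
  rewrite !form_plus, form_const, Hc1.
  replace (_ - _) with (form k (c j) z) by ring.
  apply (HcZ z m); auto.
Qed.

Lemma torus_map_base (p : nat -> R) (x : nat) (s : list nat) (b : nat) :
  Permutation s (seq 0 (length L)) -> rsum n p = 1 -> supported n L p x s ->
  In b (tonn_max_simplex n L x s) ->
  forall t, torus_map n k L c X p t = torus_point (k - 1) (angle n k L c X b p) t.
Proof.
  intros Hs Hp Hsupp Hb; unfold torus_map; apply torus_point_ext.
  intros j Hj; apply (angle_base_change p x s); auto.
  apply Hsupp; apply epsilon_spec.
  destruct (rsum_neq0_exists n p) as (v & _ & Hv); [rewrite Hp; lra | eauto].
Qed.

Lemma torus_map_continuous :
  continuous_on n (2 * (k - 1)) (tonn_realization n L) (torus_map n k L c X).
Proof.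
  intros p (Hge & H0 & Hp & x & s & Hx & Hs & Hsupp) eps Heps.
  destruct (rsum_neq0_exists n p) as (b & Hbn & Hb); [unfold rsum; rewrite Hp; lra|].
  assert (Hb0 : 0 < p b) by (specialize (Hge b); lra).
  pose (a := fun j v => Rabs (form k (c j)
               (fun i => b2R (subset_of L ((v + n - b) mod n) i)))).
  pose (M := rsum (k - 1) (fun j => rsum n (a j))).
  assert (Ha : forall j v, 0 <= a j v) by (intros; apply Rabs_pos).
  assert (HM : 0 <= M) by (apply rsum_nonneg; intros; apply rsum_nonneg; auto).
  assert (HP := PI_RGT_0).
  assert (HD : 0 < 2 * PI * M + 1) by nra.
  (* The first bound keeps [b] in the support of [q], so that [b] is a base for both points; the
     second beats the Lipschitz constant 2 PI M, the added 1 keeping the denominator positive. *)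
  exists (Rmin (p b) (eps / (2 * PI * M + 1))); split.
  { apply Rmin_glb_lt; [auto | apply Rdiv_lt_0_compat; auto]. }
  intros q (Hge' & H0' & Hp' & x' & s' & Hx' & Hs' & Hsupp') Hclose t Ht.
  assert (Hqb : q b <> 0).
  { specialize (Hclose b Hbn); intros Hq; rewrite Hq in Hclose.
    pose proof (Rmin_l (p b) (eps / (2 * PI * M + 1))).
    apply Rabs_def2 in Hclose; lra. }
  rewrite (torus_map_base p x s b), (torus_map_base q x' s' b) by auto.
  set (dl := eps / (2 * PI * M + 1)).
  apply Rle_lt_trans with (2 * PI * (M * dl)).
  - apply torus_point_lipschitz; [|exact Ht].
    intros j Hj; rewrite !angle_affine.
    match goal with |- Rabs (?u + rsum n ?F - (?u + rsum n ?G)) <= _ =>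
      replace (u + rsum n F - (u + rsum n G)) with (rsum n (fun v => F v - G v))
        by (rewrite rsum_minus; ring) end.
    eapply Rle_trans; [apply rsum_Rabs_le|].
    apply Rle_trans with (rsum n (a j) * dl).
    + rewrite Rmult_comm, <- rsum_scal; apply rsum_le; intros v Hv.
      rewrite <- Rmult_minus_distr_l, Rabs_mult, Rmult_comm.
      apply Rmult_le_compat_r; [apply Rabs_pos|].
      specialize (Hclose v Hv); pose proof (Rmin_r (p b) dl); fold dl in Hclose; lra.
    + apply Rmult_le_compat_r.
      { apply Rlt_le, Rdiv_lt_0_compat; auto. }
      apply (rsum_term_le (k - 1) j (fun j => rsum n (a j))); auto.
      intros; apply rsum_nonneg; auto.
  - assert (Hdl : dl * (2 * PI * M + 1) = eps) by (unfold dl; field; lra).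
    assert (0 < dl) by (apply Rdiv_lt_0_compat; auto).
    nra.
Qed.

Lemma base_in_simplex (x : nat) (s : list nat) :
  (x < n)%nat -> In x (tonn_max_simplex n L x s).
Proof.
  intros Hx; apply in_tonn_max_simplex; exists 0%nat; split; [lia|].
  rewrite psum_zero, Nat.add_0_r; symmetry; now apply Nat.mod_small.
Qed.

(** The base is the vertex at position 0, so the steps leading to position j are the first j entries
    of [s]. *)
Lemma steps_from_base (x j m : nat) (s : list nat) :
  Permutation s (seq 0 (length L)) -> (x < n)%nat -> (j < k)%nat -> (m < k)%nat ->
  b2R (subset_of L (((x + psum L s j) mod n + n - x) mod n) (nth m s 0%nat)) =
  b2R (Nat.ltb m j).
Proof.
  intros Hs Hx Hj Hm.
  assert (Hx0 : x = ((x + psum L s 0) mod n)%nat).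
  { rewrite psum_zero, Nat.add_0_r; symmetry; now apply Nat.mod_small. }
  rewrite Hx0 at 2.
  rewrite (vertex_difference L s n x j 0); auto; try (rewrite HL; auto; lia).
  - rewrite !(prefix_nth L s Hs) by (rewrite HL; auto).
    cbn [Nat.ltb Nat.leb b2R]; lra.
  - apply (perm_nth_lt L s Hs); now rewrite HL.
Qed.

(** * Surjectivity *)

Lemma torus_map_surj (q : nat -> R) :
  (forall y, exists h, forall j, (j < k - 1)%nat -> form k (c j) h = y j) ->
  torus (k - 1) q ->
  exists p, tonn_realization n L p /\ forall t, torus_map n k L c X p t = q t.
Proof.
  intros Hcsurj Hq.
  assert (Hn0 : (0 < n)%nat).
  { rewrite <- Hn; specialize (Hpos 0%nat ltac:(lia)).
    destruct L as [|a M]; [cbn in HL; lia | cbn in *; lia]. }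
  destruct (torus_point_surj _ _ Hq) as [y Hy].
  destruct (Hcsurj y) as [h Hh].
  pose (w := fun i => IZR (Int_part (h i))).
  pose (fr := fun i => h i - w i).
  assert (Hfr : forall i, 0 <= fr i < 1).
  { intros i; unfold fr, w; destruct (base_Int_part (h i)); lra. }
  destruct (isZ_form (length L) (fun i => INR (lval L i)) w) as [W HW];
    [intros; apply isZ_INR | intros; apply isZ_IZR |]; fold (dot L w) in HW.
  (* [x] is the vertex onto which the integral point [w] projects. *)
  pose (x := Z.to_nat (W mod Z.of_nat n)).
  pose proof (Z.mod_pos_bound W (Z.of_nat n) ltac:(lia)) as HWb.
  assert (Hx : (x < n)%nat) by (unfold x; lia).
  assert (Hxr : INR x = IZR W - IZR (W / Z.of_nat n) * INR n).
  { unfold x; rewrite INR_IZR_INZ, Z2Nat.id by lia.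
    rewrite Z.mod_eq, minus_IZR, mult_IZR, <- INR_IZR_INZ by lia; ring. }
  destruct (exists_sorted fr (seq 0 (length L))) as (s & Hs & Hsort).
  assert (Hls : length s = k) by (rewrite (perm_length L s Hs); auto).
  pose (rho := fun m => fr (nth m s 0%nat)).
  (* The barycentric coordinates of [h]: the gaps between successive sorted fractional parts, the
     base vertex taking the remainder 1 - (max - min). *)
  pose (t := fun j => match j with
                      | O => 1 - rho 0%nat + rho (k - 1)%nat
                      | S j => rho j - rho (S j)
                      end).
  pose (vt := fun j => ((x + psum L s j) mod n)%nat).
  assert (Hvt : forall j, (vt j < n)%nat) by (intros; apply Nat.mod_upper_bound; lia).
  assert (Hkk : S (k - 1) = k) by lia.
  assert (Ht : forall m, (m < k)%nat ->
            rsum k (fun j => t j * b2R (Nat.ltb m j)) = rho m - rho (k - 1)%nat).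
  { intros m Hm; rewrite <- Hkk at 1; rewrite rsum_head; cbn [t].
    change (Nat.ltb m 0) with false; cbn [b2R].
    rewrite rsum_telescope by lia; ring. }
  assert (Ht1 : rsum k t = 1).
  { rewrite <- Hkk at 1; rewrite rsum_head; cbn [t].
    rewrite (rsum_ext _ _ (fun j => (rho j - rho (S j)) * b2R (Nat.ltb 0 (S j))))
      by (intros; cbn [Nat.ltb Nat.leb b2R]; ring).
    rewrite rsum_telescope by lia; ring. }
  assert (Ht0 : forall j, (j < k)%nat -> 0 <= t j).
  { intros [|j] Hj; cbn [t].
    - pose proof (Hfr (nth 0 s 0%nat)); pose proof (Hfr (nth (k - 1) s 0%nat)).
      unfold rho; lra.
    - enough (rho (S j) <= rho j) by lra; apply Hsort; lia. }
  pose (p := fun v => rsum k (fun j => t j * b2R (Nat.eqb v (vt j)))).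
  assert (Hp : forall F, rsum n (fun v => p v * F v) = rsum k (fun j => t j * F (vt j))).
  { intros F; apply rsum_pushforward; auto. }
  assert (Hp1 : rsum n p = 1).
  { rewrite (rsum_ext n p (fun v => p v * 1)) by (intros; ring).
    rewrite (Hp (fun _ => 1)), (rsum_ext k _ t) by (intros; ring); exact Ht1. }
  assert (Hsupp : supported n L p x s).
  { intros v Hv; destruct (rsum_neq0_exists _ _ Hv) as (j & Hj & Hne).
    apply in_tonn_max_simplex; exists j; split; [lia|].
    destruct (Nat.eqb_spec v (vt j)) as [He|He]; [exact He|].
    exfalso; apply Hne; cbn; ring. }
  exists p; split.
  - repeat split.
    + intros v; apply rsum_nonneg; intros j Hj.
      apply Rmult_le_pos; [auto | apply b2R_bounds].
    + intros v Hv; unfold p; rewrite <- (rsum_const_0 k); apply rsum_ext.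
      intros j _; destruct (Nat.eqb_spec v (vt j)) as [He|He]; cbn; [|ring].
      specialize (Hvt j); lia.
    + exact Hp1.
    + exists x, s; auto.
  - intros t'; rewrite (torus_map_base p x s x), <- Hy by auto using base_in_simplex.
    apply torus_point_ext; intros j Hj; rewrite <- Hh by auto; unfold angle.
    (* The lift of [p] at [x] differs from [h] by the lattice vector x X - w and by minus the
       smallest fractional part, a constant. *)
    rewrite (form_ext k _ _ (fun i => h i + (INR x * X i - w i) + - rho (k - 1)%nat)).
    + rewrite (form_plus _ _ (fun i => h i + (INR x * X i - w i))), form_plus.
      rewrite form_const, Hc1.
      replace (_ - _) with (form k (c j) (fun i => INR x * X i - w i)) by ring.
      apply (HcZ _ (- (W / Z.of_nat n))%Z); auto.
      * intros i Hi; apply isZ_minus; [|apply isZ_IZR].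
        apply isZ_mult; auto using isZ_INR.
      * unfold dot; rewrite form_minus, form_scal; fold (dot L); fold (dot L X) (dot L w).
        rewrite HX, HW, Hxr, opp_IZR; ring.
    + intros i Hi; unfold lift; rewrite Hp.
      destruct (perm_nth_surj L s Hs i) as (m & Hm & <-); [lia|].
      rewrite (rsum_ext k _ (fun j => t j * b2R (Nat.ltb m j))).
      * rewrite Ht by lia; unfold rho at 1, fr; ring.
      * intros j' Hj'; unfold vt; rewrite steps_from_base by (auto; lia); auto.
Qed.

(** * Injectivity *)

Lemma subset_of_zero (i : nat) : (i < k)%nat -> subset_of L 0 i = false.
Proof.
  intros Hi; replace 0%nat with (subsum L (fun _ => false)).
  - apply subset_of_subsum; auto; lia.
  - apply list_sum_map_const_0; auto.
Qed.

(** Seen from [v], the vertex [v] itself has the empty step set, so only the remaining mass 1 - p(v)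
    can contribute. The centred lift therefore oscillates by at most 1 - p(v). *)
Lemma lift_own_base (p : nat -> R) (v i : nat) :
  (forall u, 0 <= p u) -> rsum n p = 1 -> (v < n)%nat -> (i < k)%nat ->
  0 <= lift n L X v p i - INR v * X i <= 1 - p v.
Proof.
  intros Hge Hp Hv Hi; unfold lift.
  match goal with |- 0 <= ?a + ?b - ?a <= _ => replace (a + b - a) with b by ring end.
  split.
  - apply rsum_nonneg; intros u _; apply Rmult_le_pos; [auto | apply b2R_bounds].
  - rewrite <- Hp at 1; rewrite <- (rsum_delta n v p Hv), <- rsum_minus.
    apply rsum_le; intros u Hu; destruct (Nat.eqb_spec u v) as [->|Hne].
    + replace ((v + n - v) mod n)%nat with 0%nat.
      * rewrite subset_of_zero by auto; cbn; lra.
      * replace (v + n - v)%nat with n by lia; symmetry; apply Nat.Div0.mod_same.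
    + pose proof (b2R_bounds (subset_of L ((u + n - v) mod n) i)).
      specialize (Hge u); nra.
Qed.

(* If an integral translate of the lift of [p] has oscillation less than 1, then
   that translate is, up to a constant, a vertex of the simplex carrying [p],
   and its barycentric coordinate is at least 1 minus the oscillation. *)
Lemma barycentric_lower_bound (p : nat -> R) (x : nat) (s : list nat) (v : nat)
    (d : nat -> Z) (r : R) :
  (forall u, 0 <= p u) -> rsum n p = 1 -> supported n L p x s ->
  Permutation s (seq 0 (length L)) -> (x < n)%nat -> (v < n)%nat -> r < 1 ->
  dot L (fun i => IZR (d i)) = INR v - INR x ->
  (forall i i', (i < k)%nat -> (i' < k)%nat ->
     (lift n L X x p i - INR x * X i - IZR (d i))
     - (lift n L X x p i' - INR x * X i' - IZR (d i')) <= r) ->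
  1 - r <= p v.
Proof.
  intros Hge Hp Hsupp Hs Hx Hv Hr Hd Hosc.
  pose (a := fun i => lift n L X x p i - INR x * X i).
  pose (sg := fun m => nth m s 0%nat).
  assert (Hsg : forall m, (m < k)%nat -> (sg m < k)%nat).
  { intros m Hm; rewrite <- HL; apply perm_nth_lt; auto; now rewrite HL. }
  destruct (choice (fun u j => p u <> 0 ->
              (j < k)%nat /\ u = ((x + psum L s j) mod n)%nat)) as [J HJ].
  { intros u; destruct (Req_dec (p u) 0) as [H0|H0]; [exists 0%nat; tauto|].
    pose proof (Hsupp u H0) as Hin; apply in_tonn_max_simplex in Hin.
    rewrite HL in Hin; destruct Hin as [j Hj]; exists j; auto. }
  (* Along [s], the value of [a] is the mass of the vertices reached after step m; hence it
     decreases, by at most 1 in all. *)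
  assert (Ha : forall m, (m < k)%nat ->
            a (sg m) = rsum n (fun u => p u * b2R (Nat.ltb m (J u)))).
  { intros m Hm; unfold a, lift.
    match goal with |- ?a + ?b - ?a = _ => replace (a + b - a) with b by ring end.
    apply rsum_ext; intros u _; destruct (Req_dec (p u) 0) as [H0|H0].
    - rewrite H0; ring.
    - destruct (HJ u H0) as [H1 H2]; rewrite H2 at 2; unfold sg.
      rewrite steps_from_base by auto; auto. }
  assert (Hmono : forall m m', (m <= m' < k)%nat -> 0 <= a (sg m) - a (sg m') <= 1).
  { intros m m' Hm; rewrite !Ha, <- rsum_minus by lia; rewrite <- Hp; split.
    - apply rsum_nonneg; intros u _; specialize (Hge u).
      destruct (Nat.ltb_spec m (J u)), (Nat.ltb_spec m' (J u)); cbn [b2R]; lra || lia.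
    - apply rsum_le; intros u _; specialize (Hge u).
      destruct (Nat.ltb_spec m (J u)), (Nat.ltb_spec m' (J u)); cbn [b2R]; lra || lia. }
  (* Since [a] drops by between 0 and 1 and [r < 1], the two oscillation bounds put this integer
     strictly between -1 and 2. *)
  assert (Hstep : forall m m', (m <= m' < k)%nat ->
            (0 <= d (sg m) - d (sg m') <= 1)%Z).
  { intros m m' Hm; pose proof (Hmono m m' Hm).
    pose proof (Hosc (sg m) (sg m') (Hsg m ltac:(lia)) (Hsg m' ltac:(lia))) as H1.
    pose proof (Hosc (sg m') (sg m) (Hsg m' ltac:(lia)) (Hsg m ltac:(lia))) as H2.
    fold (a (sg m)) (a (sg m')) in H1, H2.
    assert (-1 < IZR (d (sg m) - d (sg m')) < 2) as [H3 H4]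
      by (rewrite minus_IZR; lra).
    apply lt_IZR in H3, H4; lia. }
  assert (Hdot : forall e, (forall m, (m < k)%nat -> IZR (d (sg m)) = e (sg m)) ->
            dot L e = INR v - INR x).
  { intros e He; rewrite <- Hd; apply form_ext; intros i Hi.
    destruct (perm_nth_surj L s Hs i Hi) as (m & Hm & <-); symmetry; apply He; lia. }
  destruct (single_drop k (fun m => d (sg m)) Hstep) as [Hconst|(m & Hm & Hlow & Hhigh)].
  - assert (Hvx : v = x).
    (* n times the constant is a difference of two numbers in [0, n), so the constant is 0. *)
    { specialize (Hdot (fun _ => IZR (d (sg 0%nat)))).
      unfold dot in Hdot; rewrite form_const in Hdot; fold (dot L (fun _ => 1)) in Hdot.
      rewrite dot_one, Hn in Hdot; specialize (Hdot ltac:(intros; now rewrite Hconst)).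
      rewrite !INR_IZR_INZ, <- mult_IZR, <- minus_IZR in Hdot.
      apply eq_IZR in Hdot.
      destruct (Z.lt_trichotomy (d (sg 0%nat)) 0) as [|[E|]]; [nia | | nia].
      rewrite E in Hdot; lia. }
    pose proof (Hosc (sg 0%nat) (sg (k - 1)%nat) (Hsg 0%nat ltac:(lia))
      (Hsg (k - 1)%nat ltac:(lia))) as H1.
    fold (a (sg 0%nat)) (a (sg (k - 1)%nat)) in H1.
    rewrite (Hconst (k - 1)%nat) in H1 by lia.
    (* The total drop of [a] is the mass away from position 0, and the vertex at position 0 is
       [x]. *)
    assert (1 - p x <= a (sg 0%nat) - a (sg (k - 1)%nat)); [|rewrite Hvx; lra].
    rewrite !Ha, <- rsum_minus by lia.
    rewrite <- Hp at 1; rewrite <- (rsum_delta n x p Hx), <- rsum_minus.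
    apply rsum_le; intros u _; destruct (Req_dec (p u) 0) as [H0|H0].
    { rewrite H0; destruct (Nat.eqb u x); lra. }
    destruct (HJ u H0) as [HJk HJu]; specialize (Hge u).
    destruct (Nat.ltb_spec (k - 1) (J u)); [lia|].
    destruct (Nat.ltb_spec 0 (J u)) as [Hj|Hj]; cbn [b2R].
    { destruct (Nat.eqb u x); lra. }
    replace (J u) with 0%nat in HJu by lia.
    rewrite psum_zero, Nat.add_0_r, Nat.mod_small in HJu by auto.
    rewrite HJu, Nat.eqb_refl; lra.
  - assert (Hvm : v = ((x + psum L s m) mod n)%nat).
    (* Here [d] is the indicator of the first m steps plus a constant; applying [dot L] shows that
       [v] is the m-th vertex. *)
    { specialize (Hdot (fun i => b2R (prefix s m i) + IZR (d (sg 0%nat) - 1))).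
      unfold dot in Hdot; rewrite form_plus, form_const in Hdot.
      fold (dot L (fun _ => 1)) (dot L (fun i => b2R (prefix s m i))) in Hdot.
      rewrite dot_one, Hn, <- (INR_psum L s Hs) in Hdot.
      assert (H : INR (psum L s m) + IZR (d (sg 0%nat) - 1) * INR n = INR v - INR x).
      { apply Hdot; intros m' Hm'; unfold sg at 2.
        rewrite (prefix_nth L s Hs) by lia; rewrite minus_IZR.
        destruct (Nat.ltb_spec m' m) as [Hlt|Hlt]; cbn [b2R].
        - rewrite Hlow by auto; ring.
        - rewrite Hhigh, minus_IZR by lia; ring. }
      rewrite !INR_IZR_INZ, <- mult_IZR, <- plus_IZR, <- minus_IZR in H.
      apply eq_IZR in H; apply Nat2Z.inj; rewrite Nat2Z.inj_mod.
      apply (Z.mod_unique_pos _ _ (1 - d (sg 0%nat))%Z); lia. }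
    pose proof (Hosc (sg m) (sg (m - 1)%nat) (Hsg m ltac:(lia))
      (Hsg (m - 1)%nat ltac:(lia))) as H1.
    fold (a (sg m)) (a (sg (m - 1)%nat)) in H1.
    rewrite Hhigh, (Hlow (m - 1)%nat), minus_IZR in H1 by lia.
    (* Between positions m - 1 and m, where [d] drops by 1, [a] loses the mass carried at position
       m, which sits at [v]. *)
    assert (a (sg (m - 1)%nat) - a (sg m) <= p v); [|lra].
    rewrite !Ha, <- rsum_minus by lia; rewrite <- (rsum_delta n v p Hv).
    apply rsum_le; intros u _; specialize (Hge u).
    destruct (Nat.ltb_spec (m - 1) (J u)) as [Hj|Hj],
      (Nat.ltb_spec m (J u)) as [Hj'|Hj']; cbn [b2R];
      try (destruct (Nat.eqb u v); lra).
    destruct (Req_dec (p u) 0) as [H0|H0].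
    { rewrite H0; destruct (Nat.eqb u v); lra. }
    destruct (HJ u H0) as [_ HJu]; replace (J u) with m in HJu by lia.
    rewrite <- Hvm in HJu; rewrite HJu, Nat.eqb_refl; lra.
Qed.

(** The lift of [p] centred at [v] oscillates by at most 1 - p(v). Equal images make it, up to a
    constant, an integral translate of the lift of [p'], so [barycentric_lower_bound] applies with r
    = 1 - p(v). Exchanging [p] and [p'] then gives injectivity. *)
Lemma torus_map_inj_le (p p' : nat -> R) :
  (forall y, (forall j, (j < k - 1)%nat -> isZ (form k (c j) y)) ->
     exists r, (forall i, (i < k)%nat -> isZ (y i - r)) /\
       dot L (fun i => y i - r) = 0) ->
  tonn_realization n L p -> tonn_realization n L p' ->
  (forall t, torus_map n k L c X p t = torus_map n k L c X p' t) ->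
  forall v, p v <= p' v.
Proof.
  intros Hclattice (Hge & H0 & Hp & x & s & Hx & Hs & Hsupp)
    (Hge' & H0' & Hp' & x' & s' & Hx' & Hs' & Hsupp') Heq v.
  fold (rsum n p) in Hp; fold (rsum n p') in Hp'.
  destruct (Req_dec (p v) 0) as [Hv0|Hv0]; [rewrite Hv0; auto|].
  assert (Hv : (v < n)%nat).
  { destruct (Nat.lt_ge_cases v n); [auto|]; exfalso; auto. }
  assert (Hang : forall j, (j < k - 1)%nat ->
            isZ (angle n k L c X v p j - angle n k L c X x' p' j)).
  { apply torus_point_inj; intros t.
    rewrite <- (torus_map_base p x s v), <- (torus_map_base p' x' s' x')
      by auto using base_in_simplex; auto. }
  destruct (Hclattice (fun i => lift n L X v p i - lift n L X x' p' i))
    as (r & HrZ & Hr0).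
  { intros j Hj; rewrite form_minus; now apply Hang. }
  (* [d] is the integral vector separating the two centred lifts up to the constant [r]; as the
     lattice part is orthogonal to L, [dot L] sends it to v - x'. *)
  destruct (choice (fun i z => (i < k)%nat ->
              (INR v - INR x') * X i
              - (lift n L X v p i - lift n L X x' p' i - r) = IZR z)) as [d Hd].
  { intros i; destruct (Nat.lt_ge_cases i k) as [Hi|Hi]; [|exists 0%Z; lia].
    destruct (isZ_minus ((INR v - INR x') * X i)
                (lift n L X v p i - lift n L X x' p' i - r)) as [z Hz]; eauto.
    apply isZ_mult; [apply isZ_minus; apply isZ_INR | auto]. }
  replace (p v) with (1 - (1 - p v)) by ring.
  apply (barycentric_lower_bound p' x' s' v d); auto.
  - specialize (Hge v); lra.
  - rewrite <- (Rmult_1_r (INR v - INR x')), <- HX; unfold dot in *.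
    rewrite <- form_scal.
    match type of Hr0 with ?z = 0 => match goal with |- _ = ?w =>
      transitivity (w - z); [|rewrite Hr0; ring] end end.
    rewrite <- form_minus; apply form_ext; intros i Hi; symmetry; apply Hd; lia.
  - intros i i' Hi Hi'; rewrite <- !Hd by auto.
    pose proof (lift_own_base p v i Hge Hp Hv Hi).
    pose proof (lift_own_base p v i' Hge Hp Hv Hi'); lra.
Qed.

End Tonnetz.

(** * The homeomorphism between the tonnetz and the torus *)

Theorem theorem1p2 (k n : nat) (L : list nat) :
  (2 <= k)%nat ->
  length L = k ->
  (forall i, (i < k)%nat -> (0 < nth i L 0%nat)%nat) ->
  list_sum L = n ->
  generic L ->
  reduced L ->
  homeomorphic n (2 * (k - 1)) (tonn_realization n L) (torus (k - 1)).
Proof.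
  intros Hk HL Hpos Hn Hgen Hred.
  destruct (torus_coordinates L k) as (c & HcZ & Hc1 & Hcl & Hcs & X & HXZ & HX); auto.
  { lia. }
  { intros b Hb; destruct (In_nth _ _ 0%nat Hb) as (i & Hi & <-); apply Hpos; lia. }
  rewrite Hn in HcZ.
  apply homeomorphic_of_compact with (f := torus_map n k L c X).
  - intros p (Hge & H0 & Hp & _) i; split; [auto|].
    destruct (Nat.lt_ge_cases i n) as [Hi|Hi]; [|rewrite H0 by auto; lra].
    rewrite <- Hp; apply (rsum_term_le n i p); auto.
  - intros p (_ & H0 & _); exact H0.
  - intros q [_ H0]; exact H0.
  - apply tonn_realization_closed.
  - intros p _; apply torus_torus_point.
  - apply torus_map_continuous; auto.
  - intros p p' Hp Hp' Heq i; apply Rle_antisym.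
    + apply (torus_map_inj_le n k L c X); auto.
    + apply (torus_map_inj_le n k L c X); auto.
  - intros q Hq; apply (torus_map_surj n k L c X); auto.
Qed.
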